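(* Let $q\equiv1\pmod 6$ be a prime power, $\eta\in\widehat{\mathbb F_q^\times}$ a primitive character of order $3$, and $A,B\in\widehat{\mathbb F_q^\times}$ such that none of $A^3$, $B$, $A^3\overline B^2$, $A^6\overline B^3$, $\phi A^3\overline B$, $\phi A^3\overline B^3$ is trivial. Then for all $x\in\mathbb F_q$, $$\overline A^3(1-x)\,{}_3\mathbb F_2\!\left[\begin{matrix}A&A\eta&A\overline\eta\\&\phi B&A^3\overline B\end{matrix};\frac{27x^2}{4(1-x)^3}\right]={}_3\mathbb F_2\!\left[\begin{matrix}A^3&B&\phi A^3\overline B\\&B^2&A^6\overline B^2\end{matrix};4x\right]-\delta(x+2)\frac{g(\phi)g(\overline A^3)}{g(\phi\overline B)g(\overline A^3B)}-\delta(1-x)\sum_{\substack{\chi\in\widehat{\mathbb F_q^\times}\\\chi^3=\overline A^3}}\frac{g(\overline\chi)g(\phi\overline{B\chi})g(B\overline{A^3\chi})}{g(\phi\overline B)g(\overline A^3B)g(A^3)}\overline\chi(-4),$$ where for $x=1$ the left-hand side is interpreted as $0$.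
   Context: $\mathbb F_q$ is a finite field with $q$ elements, $q$ a power of an odd prime $p$. $\widehat{\mathbb F_q^\times}$ is the group of multiplicative characters $\chi:\mathbb F_q^\times\to\mathbb C^\times$; every character, including the trivial character $\varepsilon$, is extended to $\mathbb F_q$ by $\chi(0)=0$. $\phi$ is the quadratic character, $\overline\chi$ denotes the complex-conjugate (inverse) character, and products/powers of characters are pointwise. For $x\in\mathbb F_q$, $\delta(x)=1$ if $x=0$ and $0$ otherwise. Gauss sum: $g(A)=\sum_{x\in\mathbb F_q^\times}A(x)\zeta_p^{\mathrm{Tr}_{\mathbb F_q/\mathbb F_p}(x)}$ with $\zeta_p=e^{2\pi i/p}$. Jacobi sum: $J(A,B)=\sum_{x\in\mathbb F_q}A(x)B(1-x)$. Period functions: ${}_2\mathbb P_1\!\left[\begin{matrix}A&B\\&C\end{matrix};\lambda\right]=\sum_{y\in\mathbb F_q}B(y)\,\overline BC(1-y)\,\overline A(1-\lambda y)$ and ${}_3\mathbb P_2\!\left[\begin{matrix}A_1&A_2&A_3\\&B_1&B_2\end{matrix};\lambda\right]=\sum_{y\in\mathbb F_q}A_3(y)\,\overline{A_3}B_2(1-y)\,{}_2\mathbb P_1\!\left[\begin{matrix}A_1&A_2\\&B_1\end{matrix};\lambda y\right]$; normalized ${}_3\mathbb F_2\!\left[\begin{matrix}A_1&A_2&A_3\\&B_1&B_2\end{matrix};\lambda\right]=\frac{1}{J(A_2,B_1\overline{A_2})J(A_3,B_2\overline{A_3})}\,{}_3\mathbb P_2\!\left[\begin{matrix}A_1&A_2&A_3\\&B_1&B_2\end{matrix};\lambda\right]$.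 *)

(* Defs.v *)
From HB Require Import structures.
From mathcomp Require Import all_boot all_order all_algebra all_fingroup all_solvable all_field all_character.
Set Implicit Arguments. Unset Strict Implicit. Unset Printing Implicit Defensive.
Import Order.TTheory GRing.Theory Num.Theory.
Local Open Scope ring_scope.

(* Complex-valued functions on F_q; characters are extended by chi(0) = 0. *)
Definition cfn (F : finFieldType) := F -> algC.

(* The multiplicative group F_q^x and its (linear = all irreducible, since it is
   abelian) characters; an index i : mchar F denotes the character 'chi_i. *)
Definition UG (F : finFieldType) : {group {unit F}} := [set: {unit F}]%G.
Definition mchar (F : finFieldType) := Iirr (UG F).

Definition ch (F : finFieldType) (i : mchar F) : cfn F :=
  fun x => match (insub x : option {unit F}) with
           | Some u => 'chi_i u
           | None => 0
           end.

Definition cmul (F : finFieldType) (f g : cfn F) : cfn F := fun x => f x * g x.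
Definition cexp (F : finFieldType) (f : cfn F) (n : nat) : cfn F := fun x => f x ^+ n.
Definition cbar (F : finFieldType) (f : cfn F) : cfn F := fun x => (f x)^*.

Definition eps (F : finFieldType) : cfn F := fun x => if x == 0 then 0 else 1.
Definition qphi (F : finFieldType) : cfn F :=
  fun x => if x == 0 then 0 else if [exists y : F, y ^+ 2 == x] then 1 else -1.
Definition is_triv (F : finFieldType) (f : cfn F) : Prop := forall x : F, f x = eps x.

Definition delta (F : finFieldType) (x : F) : algC := if x == 0 then 1 else 0.

Definition charp (F : finFieldType) : nat := pdiv #|F|.
Definition degp (F : finFieldType) : nat := logn (charp F) #|F|.
Definition trF (F : finFieldType) (x : F) : F :=
  \sum_(i < degp F) x ^+ (charp F ^ i).
(* the residue k mod p with k%:R = Tr(x) (Tr(x) lies in the prime field) *)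
Definition trk (F : finFieldType) (x : F) : nat :=
  odflt 0%N (omap (@nat_of_ord _) [pick k : 'I_(charp F) | (k%:R : F) == trF x]).
Definition zetap (F : finFieldType) : algC :=
  sval (C_prim_root_exists (pdiv_gt0 #|F|)).
Definition psi (F : finFieldType) (x : F) : algC := zetap F ^+ trk x.

Definition gauss (F : finFieldType) (A : cfn F) : algC :=
  \sum_(x : F | x != 0) A x * psi x.
Definition jacobi (F : finFieldType) (A B : cfn F) : algC :=
  \sum_(x : F) A x * B (1 - x).

Definition P21 (F : finFieldType) (A B C : cfn F) (l : F) : algC :=
  \sum_(y : F) B y * cmul (cbar B) C (1 - y) * cbar A (1 - l * y).
Definition P32 (F : finFieldType) (A1 A2 A3 B1 B2 : cfn F) (l : F) : algC :=
  \sum_(y : F) A3 y * cmul (cbar A3) B2 (1 - y) * P21 A1 A2 B1 (l * y).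
Definition F32 (F : finFieldType) (A1 A2 A3 B1 B2 : cfn F) (l : F) : algC :=
  P32 A1 A2 A3 B1 B2 l /
  (jacobi A2 (cmul B1 (cbar A2)) * jacobi A3 (cmul B2 (cbar A3))).
Arguments qphi {F}.
Arguments eps {F}.

(* Main.v *)
Require Import Defs.
From HB Require Import structures.
From mathcomp Require Import all_boot all_order all_algebra all_fingroup all_solvable all_field all_character.
From mathcomp Require Import ring.
From Stdlib Require Import FunctionalExtensionality.
Import Order.TTheory GRing.Theory Num.Theory.
Local Open Scope ring_scope.
Set Implicit Arguments. Unset Strict Implicit. Unset Printing Implicit Defensive.

(** Write [a = A^3] and [C = phi a Bbar], so that [a = phi B C].  Expanding the
left-hand 3F2 over multiplicative characters [chi], the Hasse-Davenport relation
of order 3 merges its three upper Gauss sums into [g(a chi^3)]; writing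
[g(a chi^3) (a chi^3)^-1(1 - x)] as a sum over [u] of
[(a chi^3)(u) psi(u (1 - x))] is exact except at [x = 1], where the characters
with [chi^3 = a^-1] contribute the last term of the statement.  The sums over
[chi] and [u] then collapse to a quadratic character sum, i.e. to
[sum Bbar(s) Cbar(t)] over the solutions of
[s t W^2 + x W + (1 + s + t - x) = 0].  Rational substitutions turn it, up to a
term supported at [x = -2], into a sum whose Mellin transform is a product of
three Jacobi sums, and the relation of order 2 identifies it with the right-hand
3F2.

The relation of order 3 itself comes from Cardano's formula: for [m <> 0] the
number of roots of [v^3 - 3 m v = s] is [1 + sum eta(y)] over [y + m^3/y = s]. *)


(** * The additive character *)

(** The recurring obstacle is uniformity: in a Fourier expansion each identity between Gauss and
    Jacobi sums is needed for every [chi], including those for which some product of characters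
    degenerates. Therefore Jacobi sums are always expressed through the Gauss sum at the conjugate
    of the product, a form that survives a trivial product, and the contributions of exceptional
    fibres are kept until they cancel against the remaining degenerations.

    The constants have separate origins. In [27 x^2 / (4 (1 - x)^3)] the [27] is absorbed by the
    order 3 relation and the cube by [chi^3]; the remaining [x^2 / 4] turns the argument of the
    quadratic character into a discriminant. The [4] in [4 x] comes from the order 2 relation. The
    point [x = -2] appears because a Moebius map met on one exceptional fibre becomes constant
    there. *)

Section AdditiveCharacter.
Variable F : finFieldType.
Implicit Types x y z : F.
Local Notation p := (charp F).

(** [charp] and [degp] are read off the cardinality alone; since that is a prime power, they are the
    characteristic and the degree. *)
Lemma card_charp : #|F| = (p ^ degp F)%N /\ p \in [pchar F].
Proof.
have [r r_pr rF] := finPcharP F.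
have cF := card_pprimeChar rF.
have l_gt0 : (0 < logn r #|F|)%N.
  by rewrite lt0n; apply: contraTneq (finNzRing_gt1 F) => l0; rewrite cF l0.
have pr : p = r by rewrite /charp cF -(prednK l_gt0) pdiv_pfactor.
by rewrite /degp pr.
Qed.

Lemma pchar_charp : p \in [pchar F]. Proof. by case: card_charp. Qed.
Lemma charp_prime : prime p. Proof. exact: pcharf_prime pchar_charp. Qed.

Lemma degp_gt0 : (0 < degp F)%N.
Proof.
rewrite lt0n; apply: contraTneq (finNzRing_gt1 F) => l0.
by rewrite card_charp.1 l0.
Qed.

Lemma charp_exprD n x y : (x + y) ^+ (p ^ n) = x ^+ (p ^ n) + y ^+ (p ^ n).
Proof.
apply: exprDn_pchar; rewrite (eq_pnat _ (pcharf_eq pchar_charp)).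
by rewrite pnatX pnat_id ?charp_prime.
Qed.

Lemma trFD x y : trF (x + y) = trF x + trF y.
Proof. by rewrite /trF -big_split; apply: eq_bigr => i _; rewrite charp_exprD. Qed.

(** Frobenius permutes the summands cyclically, because [x ^+ #|F| = x]. With [prime_fieldP] this
    places the trace in the prime field. *)
Lemma trF_frobenius x : trF x ^+ p = trF x.
Proof.
have frob_sum (G : nat -> F) n : (\sum_(i < n) G i) ^+ p = \sum_(i < n) (G i) ^+ p.
  elim: n => [|n IHn]; first by rewrite !big_ord0 expr0n gtn_eqF ?prime_gt0 ?charp_prime.
  by rewrite !big_ord_recr /= -[p in LHS]expn1 charp_exprD expn1 IHn.
rewrite /trF (frob_sum (fun i => x ^+ (p ^ i))).
case: (degp F) degp_gt0 card_charp => // d _ [cF _].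
rewrite big_ord_recr big_ord_recl addrC /= expn0 expr1.
rewrite -exprM -expnSr -cF expf_card; congr (_ + _).
by apply: eq_bigr => i _; rewrite -exprM -expnSr.
Qed.

(** The trace is a nonzero polynomial of degree at most [p ^ (d - 1)], too small to vanish at all
    [p ^ d] points. *)
Lemma trF_neq0 : exists x, trF x != 0.
Proof.
pose P : {poly F} := \sum_(i < degp F) 'X^(p ^ i).
have PE x : P.[x] = trF x.
  by rewrite /P horner_sum; apply: eq_bigr => i _; rewrite hornerXn.
have p_gt1 := prime_gt1 charp_prime.
have sizeP : (size P <= (p ^ (degp F).-1).+1)%N.
  apply: leq_trans (size_sum _ _ _) _; apply/bigmax_leqP => i _ /=; rewrite size_polyXn ltnS leq_exp2l //.
  by rewrite -ltnS prednK ?degp_gt0.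
have P0 : P != 0.
  apply/eqP => P0; have := congr1 (fun Q : {poly F} => Q`_1) P0.
  rewrite coef0 /P coef_sum (bigD1 (Ordinal degp_gt0)) //= coefXn expn0 eqxx.
  rewrite big1 ?addr0; first by move/eqP; rewrite oner_eq0.
  move=> i; rewrite -val_eqE /= coefXn => i0.
  by rewrite -{1}(expn0 p) eqn_exp2l // eq_sym (negbTE i0).
apply/existsP; rewrite -[[exists _, _]]negbK negb_exists; apply/negP => /forallP tr0.
have := max_poly_roots P0 (rs := enum F).
rewrite enum_uniq -cardE => /(_ _ isT) H.
have /H : all (root P) (enum F).
  by apply/allP => x _; rewrite rootE PE; have := tr0 x; rewrite negbK.
move=> /leq_trans/(_ sizeP); rewrite ltnS card_charp.1 leq_exp2l //.
by rewrite leqNgt prednK ?degp_gt0 // leqnn.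
Qed.

(** The [p] residues are already [p] distinct roots of ['X^p - 'X]; any further fixed point of
    Frobenius would be one root too many. *)
Lemma prime_fieldP z : z ^+ p = z -> exists k : 'I_p, (k%:R : F) == z.
Proof.
move=> zp; have p_gt1 := prime_gt1 charp_prime.
have p_ndvd (i : 'I_p) (j : 'I_p) : (i%:R : F) = j%:R -> i = j.
  wlog le_ij : i j / (i <= j)%N.
    by move=> H; case: (leqP i j) => [/H//|/ltnW/H h e]; rewrite h.
  move=> e; apply/val_inj/eqP; rewrite eqn_leq le_ij -subn_eq0 /=.
  have : (p %| j - i)%N by rewrite (dvdn_pcharf pchar_charp) natrB // e subrr.
  by apply: contraLR; rewrite -lt0n => h; rewrite gtnNdvd // (leq_ltn_trans (leq_subr _ _)).
apply/existsP; case: existsP => // nex; have nz (i : 'I_p) : (i%:R : F) != z.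
  by apply/negP => e; apply: nex; exists i.
pose P : {poly F} := 'X^p - 'X.
have sP : size P = p.+1.
  by rewrite /P size_polyDl ?size_polyXn // size_polyN size_polyX ltnS.
have P0 : P != 0 by rewrite -size_poly_gt0 sP.
have rootP : all (root P) (z :: [seq i%:R | i : 'I_p]).
  apply/allP => y; rewrite inE rootE /P !hornerE.
  case/orP => [/eqP->|/mapP[i _ ->]]; first by rewrite zp subrr.
  by rewrite -(pFrobenius_autE pchar_charp) pFrobenius_aut_nat subrr.
have u : uniq (z :: [seq i%:R | i : 'I_p]).
  rewrite /= map_inj_uniq ?enum_uniq ?andbT //.
  by apply/mapP => -[i _ e]; have := nz i; rewrite e eqxx.
by have := max_poly_roots P0 rootP u; rewrite sP /= size_map size_enum_ord ltnn.
Qed.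

(** The search in [trk] always succeeds, so its default value is never returned. *)
Lemma trkE x : ((trk x)%:R : F) = trF x.
Proof.
rewrite /trk; case: pickP => [k /eqP//|h].
by have [k] := prime_fieldP (trF_frobenius x); rewrite h.
Qed.

Lemma zetap_prim : p.-primitive_root (zetap F).
Proof. exact: (svalP (C_prim_root_exists (pdiv_gt0 #|F|))). Qed.

Lemma natr_pchar_eq m n : ((m%:R : F) == n%:R) = (m == n %[mod p])%N.
Proof.
wlog le_mn : m n / (m <= n)%N.
  by move=> H; case: (leqP m n) => [/H//|/ltnW/H e]; rewrite eq_sym e eq_sym.
by rewrite eq_sym -subr_eq0 -natrB // -(dvdn_pcharf pchar_charp) eq_sym eqn_mod_dvd.
Qed.

Lemma psiD x y : psi (x + y) = psi x * psi y.
Proof.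
rewrite /psi -exprD; apply/eqP; rewrite (eq_prim_root_expr zetap_prim).
by rewrite -natr_pchar_eq natrD !trkE trFD.
Qed.

Lemma psi_eq1 x : (psi x == 1) = (trF x == 0).
Proof.
rewrite /psi -(expr0 (zetap F)) (eq_prim_root_expr zetap_prim).
by rewrite -natr_pchar_eq trkE.
Qed.

Lemma psi0 : psi (0 : F) = 1.
Proof. by apply/eqP; rewrite psi_eq1; have /eqP := trFD 0 0; rewrite addr0 -subr_eq subrr eq_sym. Qed.

Lemma sum_psi (c : F) : \sum_(x : F) psi (c * x) = if c == 0 then #|F|%:R else 0.
Proof.
case: eqVneq => [->|c0].
  by rewrite (eq_bigr (fun=> 1)) => [|x _]; rewrite ?mul0r ?psi0 // sumr_const.
have [t] := trF_neq0; rewrite -psi_eq1 => t1.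
have /eqP : \sum_x psi (c * x) = psi t * \sum_x psi (c * x).
  rewrite mulr_sumr (reindex_inj (addIr (t / c))) /=; apply: eq_bigr => x _.
  by rewrite mulrDr mulrCA divff // mulr1 addrC psiD.
by rewrite -subr_eq0 -{1}[\sum_x _]mul1r -mulrBl mulf_eq0 subr_eq0 eq_sym (negbTE t1) => /eqP.
Qed.

End AdditiveCharacter.

(** * Multiplicative characters *)

Section MultiplicativeCharacters.
Variable F : finFieldType.
Implicit Types (x y z : F) (X Y : cfn F).

(** These laws are stable under products, conjugates and positive powers, so the argument can work
    with plain functions and never has to name the index in [mchar F] of a composite character. *)
Definition mulchar X :=
  [/\ X 0 = 0, X 1 = 1 & forall x y, X (x * y) = X x * X y].
Definition nontriv X := exists2 t : F, t != 0 & X t != 1.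

Lemma mc0 X : mulchar X -> X 0 = 0. Proof. by case. Qed.
Lemma mc1 X : mulchar X -> X 1 = 1. Proof. by case. Qed.
Lemma mcM X x y : mulchar X -> X (x * y) = X x * X y. Proof. by case. Qed.

Lemma mcX X x n : mulchar X -> X (x ^+ n) = X x ^+ n.
Proof.
by move=> hX; elim: n => [|n IHn]; rewrite ?expr0 ?mc1 // !exprS mcM // IHn.
Qed.

Lemma mc_neq0 X x : mulchar X -> x != 0 -> X x != 0.
Proof.
move=> hX x0; apply: contra_neq (oner_neq0 algC) => Xx0.
by rewrite -(mc1 hX) -(divff x0) mcM // Xx0 mul0r.
Qed.

Lemma mcV X x : mulchar X -> X x^-1 = (X x)^-1.
Proof.
move=> hX; case: (eqVneq x 0) => [->|x0]; first by rewrite invr0 mc0 // invr0.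
apply: (mulIf (mc_neq0 hX x0)).
by rewrite mulVf ?mc_neq0 // -mcM // mulVf // mc1.
Qed.

Lemma mcD X x y : mulchar X -> X (x / y) = X x / X y.
Proof. by move=> hX; rewrite mcM // mcV. Qed.

(** On units the values are roots of unity; at 0 both sides vanish because [0^-1 = 0]. *)
Lemma mc_conj X x : mulchar X -> (X x)^* = (X x)^-1.
Proof.
move=> hX; case: (eqVneq x 0) => [->|x0]; first by rewrite mc0 // conjC0 invr0.
have q_gt0 : (0 < #|F|.-1)%N by rewrite -subn1 subn_gt0 finNzRing_gt1.
have xq : x ^+ #|F|.-1 = 1.
  apply: (mulfI x0); rewrite -exprS prednK ?expf_card ?mulr1 //.
  exact: ltnW (finNzRing_gt1 F).
suff n1 : `|X x| = 1 by rewrite invC_norm n1 expr1n invr1 mul1r.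
by apply/eqP; rewrite -(pexpr_eq1 q_gt0) // -normrX -mcX // xq mc1 // normr1.
Qed.

Lemma mcN1_sqr X : mulchar X -> X (-1) * X (-1) = 1.
Proof. by move=> hX; rewrite -mcM // mulrNN mulr1 mc1. Qed.

Lemma mc_cmul X Y : mulchar X -> mulchar Y -> mulchar (cmul X Y).
Proof.
move=> hX hY; split; rewrite /cmul ?mc0 ?mc1 ?mulr0 ?mulr1 // => x y.
by rewrite !mcM // mulrACA.
Qed.

Lemma mc_cbar X : mulchar X -> mulchar (cbar X).
Proof.
move=> hX; split; rewrite /cbar ?mc0 ?mc1 ?rmorph0 ?rmorph1 // => x y.
by rewrite mcM // rmorphM.
Qed.

(** The exponent has to be positive: [cexp X 0] takes the value 1 at 0. *)
Lemma mc_cexp X n : mulchar X -> mulchar (cexp X n.+1).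
Proof.
move=> hX; split; rewrite /cexp ?mc0 ?mc1 ?expr1n ?expr0n // => x y.
by rewrite mcM // exprMn.
Qed.

Lemma mc_eps : mulchar (@eps F).
Proof.
split; rewrite /eps ?eqxx ?oner_eq0 // => x y.
by rewrite mulf_eq0; do 2!case: eqP => _ /=; rewrite ?mulr0 ?mulr1.
Qed.

Lemma is_trivE X : is_triv X -> X = eps.
Proof. by move=> hX; apply: functional_extensionality. Qed.

Lemma trivVnontriv X : mulchar X -> is_triv X \/ nontriv X.
Proof.
move=> hX; case: (boolP [forall x, X x == eps x]) => [/forallP h|].
  by left=> x; apply/eqP.
case/forallPn=> t; case: (eqVneq t 0) => [->|t0].
  by rewrite (mc0 hX) (mc0 mc_eps) eqxx.
by rewrite {1}/eps (negbTE t0) => ht; right; exists t.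
Qed.

Lemma nontrivP X : mulchar X -> ~ is_triv X -> nontriv X.
Proof. by move=> hX hn; case: (trivVnontriv hX). Qed.

Lemma cfn_ext X Y : mulchar X -> mulchar Y -> (forall z, z != 0 -> X z = Y z) -> X = Y.
Proof.
move=> hX hY XY; apply: functional_extensionality => z.
by case: (eqVneq z 0) => [->|/XY//]; rewrite (mc0 hX) (mc0 hY).
Qed.

Lemma cbarE X z : mulchar X -> cbar X z = (X z)^-1.
Proof. exact: mc_conj. Qed.

Lemma mcN1V X : mulchar X -> (X (-1))^-1 = X (-1).
Proof.
move=> hX; have h := mcN1_sqr hX.
have X0 : X (-1) != 0 by rewrite mc_neq0 // oppr_eq0 oner_eq0.
by apply: (mulfI X0); rewrite h divff.
Qed.

Lemma nontriv_cbar X : mulchar X -> nontriv X -> nontriv (cbar X).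
Proof.
move=> hX [t t0 t1]; exists t => //; rewrite cbarE //.
by apply: contra_neq t1 => e; rewrite -[X t]invrK e invr1.
Qed.

Lemma sum_shift (f : F -> algC) c : \sum_x f x = \sum_x f (x + c).
Proof. exact: reindex_inj (addIr c). Qed.

Lemma sum_opp (f : F -> algC) : \sum_x f x = \sum_x f (- x).
Proof. exact: reindex_inj oppr_inj. Qed.

Lemma sum_scale (f : F -> algC) c : c != 0 -> \sum_x f x = \sum_x f (c * x).
Proof. by move=> c0; apply: reindex_inj; apply: mulfI. Qed.

Lemma sum_inv (f : F -> algC) : \sum_x f x = \sum_x f x^-1.
Proof. by apply: reindex_inj; apply: invr_inj. Qed.

Lemma sum_nontriv X : mulchar X -> nontriv X -> \sum_x X x = 0.
Proof.
move=> hX [t t0 t1]; have /eqP := sum_scale X t0.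
under [X in _ == X]eq_bigr do rewrite mcM //.
rewrite -mulr_sumr -subr_eq0 -{1}[\sum_x _]mul1r -mulrBl mulf_eq0 subr_eq0.
by rewrite eq_sym (negbTE t1) => /eqP.
Qed.

Lemma sum_delta (a : F) (f : F -> algC) : \sum_x (x == a)%:R * f x = f a.
Proof.
rewrite (bigD1 a) //= eqxx mul1r big1 ?addr0 // => x /negbTE->.
by rewrite mul0r.
Qed.

Lemma sum_eps (f : F -> algC) : \sum_x eps x * f x = \sum_x f x - f 0.
Proof.
rewrite -(sum_delta 0 f) -sumrB; apply: eq_bigr => x _.
by rewrite /eps; case: eqP => _; rewrite ?mul0r ?mul1r ?subrr ?subr0.
Qed.

Lemma sum_triv : \sum_x (@eps F) x = #|F|%:R - 1.
Proof.
have := sum_eps (fun=> 1); rewrite sumr_const => <-.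
by apply: eq_bigr => x _; rewrite mulr1.
Qed.

Lemma mc_ch (i : mchar F) : mulchar (ch i).
Proof.
have lin : 'chi_i \is a linear_char.
  apply: (char_abelianP _ _ i); apply/centsP => u _ v _.
  by apply: val_inj; rewrite !FinRing.val_unitM mulrC.
have chU (u : {unit F}) : ch i (val u) = 'chi_i u.
  by rewrite /ch; case: insubP => [v _ /val_inj->|]; rewrite ?(valP u).
have ch0 : ch i 0 = 0 by rewrite /ch; case: insubP => // v; rewrite unitr0.
split=> // [|x y].
  by rewrite -(FinRing.val_unit1 F) chU lin_char1.
case: (eqVneq x 0) => [->|x0]; first by rewrite mul0r ch0 mul0r.
case: (eqVneq y 0) => [->|y0]; first by rewrite mulr0 ch0 mulr0.
have Ux : x \is a GRing.unit by rewrite unitfE.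
have Uy : y \is a GRing.unit by rewrite unitfE.
have := chU (FinRing.unit F Ux * FinRing.unit F Uy)%g.
by rewrite FinRing.val_unitM /= => ->; rewrite lin_charM ?inE // -!chU.
Qed.

Lemma sum_ch x y : x != 0 -> y != 0 ->
  \sum_(i : mchar F) ch i x * (ch i y)^* = (x == y)%:R * (#|F|%:R - 1).
Proof.
move=> x0 y0.
have Ux : x \is a GRing.unit by rewrite unitfE.
have Uy : y \is a GRing.unit by rewrite unitfE.
pose u := FinRing.unit F Ux; pose v := FinRing.unit F Uy.
have chU i (w : {unit F}) : ch i (val w) = 'chi_i w.
  by rewrite /ch; case: insubP => [w' _ /val_inj->|]; rewrite ?(valP w).
have ab : abelian (UG F).
  by apply/centsP => a _ b _; apply: val_inj; rewrite !FinRing.val_unitM mulrC.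
have vG : v \in UG F by rewrite inE.
have := second_orthogonality_relation u vG.
rewrite (eq_bigr (fun i => ch i x * (ch i y)^*)) => [->|i _]; last by rewrite -!chU.
have -> : (u \in (v ^: UG F)%g) = (x == y).
  by rewrite (abelian_classP _ ab) ?inE // -val_eqE.
have -> : 'C_(UG F)[u]%g = [set: {unit F}].
  apply/setP => w; rewrite in_setI !in_setT /=; apply/cent1P.
  by apply: val_inj; rewrite !FinRing.val_unitM mulrC.
rewrite card_finField_unit -subn1 natrB ?(ltnW (finNzRing_gt1 F)) //.
by case: eqP; rewrite ?mul1r ?mul0r ?mulr1n ?mulr0n.
Qed.

Lemma card_neq0 : (#|F|%:R : algC) != 0.
Proof. by rewrite pnatr_eq0 -lt0n (ltnW (finNzRing_gt1 F)). Qed.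

Lemma cardB1_neq0 : (#|F|%:R - 1 : algC) != 0.
Proof.
by rewrite subr_eq0 (eqr_nat _ _ 1) gtn_eqF // finNzRing_gt1.
Qed.

(** Fourier inversion on the multiplicative group. Characters do not see the value at 0, which is
    why [x = 0] is a separate case of the theorem. *)
Lemma mellin_inv (f : F -> algC) x : x != 0 ->
  (#|F|%:R - 1) * f x = \sum_(i : mchar F) ch i x * \sum_y cbar (ch i) y * f y.
Proof.
move=> x0; under eq_bigr do rewrite mulr_sumr.
rewrite exchange_big /= (eq_bigr (fun y => (y == x)%:R * ((#|F|%:R - 1) * f y))).
  by rewrite sum_delta.
move=> y _; under eq_bigr do rewrite mulrA; rewrite -mulr_suml.
case: (eqVneq y 0) => [->|y0].
  rewrite eq_sym (negbTE x0) mul0r big1 ?mul0r // => i _.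
  by rewrite /cbar (mc0 (mc_ch i)) rmorph0 mulr0.
by rewrite sum_ch // eq_sym mulrA.
Qed.

(** Discrete logarithms: questions about squares and cubes become congruences modulo [q - 1]. *)
Lemma gen_unit : exists2 u : F, u != 0 &
  (forall x, x != 0 -> exists k, x = u ^+ k) /\
  (forall j k, u ^+ j = u ^+ k -> j = k %[mod #|F|.-1]).
Proof.
have /cyclicP [w Hw] := field_unit_group_cyclic [set: {unit F}]%G.
have ow : #[w]%g = #|F|.-1 by rewrite /order -Hw card_finField_unit.
exists (val w); first by rewrite -unitfE (valP w).
split=> [x x0|j k].
  have Ux : x \is a GRing.unit by rewrite unitfE.
  have : FinRing.unit F Ux \in <[w]>%g by rewrite -Hw inE.
  case/cycleP=> k hk; exists k.
  by rewrite -FinRing.val_unitX -hk.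
rewrite -!FinRing.val_unitX => /val_inj/eqP; rewrite eq_expg_mod_order ow.
by move/eqP.
Qed.

Lemma natr_coprime_neq0 m : coprime m #|F| -> (m%:R : F) != 0.
Proof.
apply: contraL => /eqP m0; have := pchar_charp F.
rewrite /coprime; move=> pF; apply/negP => /eqP g1.
have : (charp F %| gcdn m #|F|)%N.
  rewrite dvdn_gcd (dvdn_pcharf pF) m0 eqxx /= (card_charp F).1.
  by rewrite dvdn_exp ?degp_gt0.
by rewrite g1 dvdn1; have := prime_gt1 (charp_prime F); case: (charp F) => [|[]].
Qed.

End MultiplicativeCharacters.

(** * The quadratic character *)

Section QuadraticCharacter.
Variable F : finFieldType.
Hypothesis oddF : odd #|F|.
Implicit Types x y z : F.

Lemma two_neq0 : (2%:R : F) != 0.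
Proof. by apply: natr_coprime_neq0; rewrite coprime2n. Qed.

Lemma sqr_gen (u : F) k : (forall j k, u ^+ j = u ^+ k -> j = k %[mod #|F|.-1]) ->
  (forall x, x != 0 -> exists k, x = u ^+ k) -> u != 0 ->
  [exists y : F, y ^+ 2 == u ^+ k] = ~~ odd k.
Proof.
move=> uinj gen u0; apply/existsP/idP => [[y /eqP yk]|ek].
  have y0 : y != 0.
    by apply: contra_neq (expf_neq0 k u0) => y0; rewrite -yk y0 expr0n.
  have [j yj] := gen _ y0; move: yk; rewrite yj -exprM => /uinj e.
  have ev : (2 %| #|F|.-1)%N.
    by rewrite dvdn2 -subn1 oddB ?(ltnW (finNzRing_gt1 F)) // oddF.
  have : (j * 2 = k %[mod 2])%N.
    by rewrite -(modn_dvdm (j * 2) ev) e modn_dvdm.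
  by rewrite modnMl modn2; case: (odd k).
by exists (u ^+ k./2); rewrite -exprM muln2 even_halfK.
Qed.

Lemma qphi_gen : exists2 u : F, u != 0 &
  (forall x, x != 0 -> exists k, x = u ^+ k) /\
  (forall k, qphi (u ^+ k) = (-1) ^+ k).
Proof.
have [u u0 [gen uinj]] := gen_unit F; exists u => //; split=> // k.
rewrite /qphi expf_eq0 (negbTE u0) andbF sqr_gen // -signr_odd.
by case: (odd k).
Qed.

Lemma mc_qphi : mulchar (@qphi F).
Proof.
have [u u0 [gen phiu]] := qphi_gen.
have phi0 : qphi (0 : F) = 0 by rewrite /qphi eqxx.
split=> // [|x y]; first by rewrite -(expr0 u) phiu.
case: (eqVneq x 0) => [->|/gen[j ->]]; first by rewrite mul0r phi0 mul0r.
case: (eqVneq y 0) => [->|/gen[k ->]]; first by rewrite mulr0 phi0 mulr0.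
by rewrite -exprD !phiu exprD.
Qed.

Lemma qphi_nontriv : nontriv (@qphi F).
Proof.
have [u u0 [gen phiu]] := qphi_gen; exists u => //.
by rewrite -(expr1 u) phiu expr1 eq_sym -subr_eq0 opprK (eqr_nat _ 2 0).
Qed.

Lemma qphiV x : (qphi x)^-1 = qphi x.
Proof. by rewrite /qphi; case: ifP => _; [|case: ifP => _]; rewrite ?invr0 ?invr1 ?invrN1. Qed.

Lemma qphi_sqr x : x != 0 -> qphi x * qphi x = 1.
Proof. by move=> x0; rewrite -{2}qphiV divff // mc_neq0 //; apply: mc_qphi. Qed.

Lemma qphiX2 x : x != 0 -> qphi (x ^+ 2) = 1.
Proof. by move=> x0; rewrite mcX ?expr2 ?qphi_sqr //; apply: mc_qphi. Qed.

Lemma order2_qphi (D : cfn F) : mulchar D -> is_triv (cexp D 2) -> nontriv D ->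
  D = qphi.
Proof.
move=> hD D2 [t t0 Dt1]; have [u u0 [gen phiu]] := qphi_gen.
have : D u ^+ 2 == 1 ^+ 2 by rewrite expr1n; have := D2 u; rewrite /cexp /eps (negbTE u0) => ->.
rewrite eqf_sqr => /orP [/eqP Du1|/eqP DuN1].
  by have [k tk] := gen _ t0; move: Dt1; rewrite tk mcX // Du1 expr1n eqxx.
apply: functional_extensionality => x; case: (eqVneq x 0) => [->|/gen [k ->]].
  by rewrite mc0 // mc0 //; apply: mc_qphi.
by rewrite mcX // DuN1 phiu.
Qed.

Lemma card_sqrt x : \sum_(y : F | y ^+ 2 == x) 1 = 1 + qphi x.
Proof.
case: (eqVneq x 0) => [->|x0].
  by rewrite /qphi eqxx addr0 (big_pred1 0) // => y; rewrite expf_eq0.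
rewrite /qphi (negbTE x0); case: existsP => [[z /eqP zx]|nex].
  have z0 : z != 0 by apply: contra_neq x0 => z0; rewrite -zx z0 expr0n.
  have zN : - z != z.
    by rewrite -subr_eq0 -opprD oppr_eq0 -mulr2n -mulr_natl mulf_neq0 ?two_neq0.
  rewrite (eq_bigl (fun y => (y == z) || (y == - z))) => [|y]; last by rewrite -zx eqf_sqr.
  rewrite (bigD1 z) ?eqxx //= (big_pred1 (- z)) // => y /=.
  by case: (eqVneq y z) => [->|] /=; rewrite ?andbT // eq_sym (negbTE zN).
by rewrite subrr big_pred0 // => y; apply/negP => h; apply: nex; exists y.
Qed.

Lemma card_quad (a b c : F) : a != 0 ->
  \sum_(w : F | a * w ^+ 2 + b * w + c == 0) 1 = 1 + qphi (b ^+ 2 - 4%:R * a * c).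
Proof.
move=> a0; have t0 := two_neq0.
have a20 : 2%:R * a != 0 by rewrite mulf_neq0.
rewrite -card_sqrt.
have inj : injective (fun w : F => 2%:R * a * w + b) by move=> v w /addIr /(mulfI a20).
rewrite [RHS](reindex_inj inj) /=; apply: eq_bigl => w.
have a40 : 4%:R * a != 0 by rewrite (natrM _ 2 2) -mulrA mulf_neq0.
rewrite -(inj_eq (mulfI a40)) mulr0 -[RHS]subr_eq0; congr (_ == 0); ring.
Qed.

End QuadraticCharacter.

(** * Gauss and Jacobi sums *)

Section GaussJacobi.
Variable F : finFieldType.
Implicit Types (x y z c : F) (X Y D : cfn F).
Local Notation q := (#|F|%:R : algC).

Lemma gaussE X : mulchar X -> gauss X = \sum_x X x * psi x.
Proof.
move=> hX; rewrite /gauss big_mkcond; apply: eq_bigr => x _.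
by case: eqP => // ->; rewrite mc0 // mul0r.
Qed.

Lemma gauss_scale X c : mulchar X -> c != 0 ->
  \sum_x X x * psi (c * x) = (X c)^-1 * gauss X.
Proof.
move=> hX c0; rewrite gaussE // (sum_scale _ (invr_neq0 c0)) mulr_sumr.
by apply: eq_bigr => x _; rewrite (mcM _ _ hX) (mcV _ hX) mulVKf // mulrA.
Qed.

(** At [c = 0] the left side vanishes by orthogonality and the right side because [(X 0)^-1 = 0].
    For [X = phi] this absorbs the zeros of the quadratic argument. *)
Lemma gauss_scale_nontriv X c : mulchar X -> nontriv X ->
  \sum_x X x * psi (c * x) = (X c)^-1 * gauss X.
Proof.
move=> hX nX; case: (eqVneq c 0) => [->|c0]; last exact: gauss_scale.
rewrite mc0 // invr0 mul0r -[RHS](sum_nontriv hX nX).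
by apply: eq_bigr => x _; rewrite mul0r psi0 mulr1.
Qed.

Lemma gauss_eps : gauss (@eps F) = -1.
Proof.
rewrite gaussE; last exact: mc_eps.
rewrite sum_eps psi0; have := sum_psi (1 : F); rewrite oner_eq0.
by under eq_bigr do rewrite mul1r; move=> ->; rewrite sub0r.
Qed.

Lemma gauss_conj X : mulchar X -> nontriv X ->
  gauss X * gauss (cbar X) = X (-1) * q.
Proof.
move=> hX nX; have hX' := mc_cbar hX.
rewrite (gaussE hX') mulr_sumr.
rewrite (eq_bigr (fun z => eps z * \sum_x X x * psi ((1 + x) * z))); last first.
  move=> z _; rewrite /eps; case: (eqVneq z 0) => [->|z0].
    by rewrite /cbar (mc0 hX) conjC0 mul0r mulr0 mul0r.
  rewrite mul1r /cbar mc_conj // mulrA -[_ * (X z)^-1]mulrC -gauss_scale //.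
  rewrite mulr_suml; apply: eq_bigr => x _.
  by rewrite -mulrA -psiD mulrDl mul1r addrC [z * x]mulrC.
rewrite sum_eps exchange_big /=.
rewrite [X in _ - X](eq_bigr X) => [|x _]; last by rewrite mulr0 psi0 mulr1.
rewrite (sum_nontriv hX nX) subr0.
under eq_bigr do rewrite -mulr_sumr sum_psi.
rewrite (bigD1 (-1)) //= subrr eqxx big1 ?addr0 // => x x1.
by rewrite addrC -(opprK 1) subr_eq0 (negbTE x1) mulr0.
Qed.

Lemma gauss_neq0 X : mulchar X -> gauss X != 0.
Proof.
move=> hX; case: (trivVnontriv hX) => [/is_trivE->|nX].
  by rewrite gauss_eps oppr_eq0 oner_eq0.
have : gauss X * gauss (cbar X) != 0.
  by rewrite gauss_conj // mulf_neq0 ?card_neq0 // mc_neq0 // oppr_eq0 oner_eq0.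
by apply: contra_neq => ->; rewrite mul0r.
Qed.

(** With the third Gauss sum at the conjugate of [X Y], instead of a division by the Gauss sum of
    [X Y], the formula stays true when [X Y] is trivial. It fails only when both characters are
    trivial: the sides are then [q (q - 2)] and [-1]. *)
Lemma jacobi_gauss X Y : mulchar X -> mulchar Y -> nontriv X \/ nontriv Y ->
  q * jacobi X Y = X (-1) * Y (-1) * gauss X * gauss Y * gauss (cbar (cmul X Y)).
Proof.
move=> hX hY nXY; have hXY := mc_cmul hX hY; have hZ := mc_cbar hXY.
have -> : X (-1) * Y (-1) * gauss X * gauss Y * gauss (cbar (cmul X Y)) =
   X (-1) * Y (-1) * \sum_z eps z * \sum_x \sum_y X x * Y y * psi ((1 + x + y) * z).
  rewrite -!mulrA; congr (_ * (_ * _)); rewrite (gaussE hZ) !mulr_sumr.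
  apply: eq_bigr => z _; rewrite /eps; case: (eqVneq z 0) => [->|z0].
    by rewrite (mc0 hZ) !(mul0r, mulr0).
  rewrite mul1r /cbar mc_conj // /cmul invfM.
  have -> : gauss X * (gauss Y * ((X z)^-1 / Y z * psi z)) =
     ((X z)^-1 * gauss X) * ((Y z)^-1 * gauss Y) * psi z by ring.
  rewrite -!gauss_scale // -mulrA mulr_suml; apply: eq_bigr => x _.
  rewrite mulr_suml mulr_sumr; apply: eq_bigr => y _.
  by rewrite !mulrDl mul1r !psiD ![z * _]mulrC; ring.
(* Completing the sum by [z = 0] costs [(\sum X) (\sum Y)], which is 0 since one of the two
   characters is nontrivial. *)
rewrite sum_eps [X in _ - X](_ : _ = 0) ?subr0; last first.
  have -> : \sum_x \sum_y X x * Y y * psi ((1 + x + y) * 0) = (\sum_x X x) * (\sum_y Y y).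
    rewrite mulr_suml; apply: eq_bigr => x _; rewrite mulr_sumr.
    by apply: eq_bigr => y _; rewrite mulr0 psi0 mulr1.
  by case: nXY => h; rewrite (sum_nontriv _ h) // ?mul0r ?mulr0.
rewrite exchange_big /=; under [X in _ = _ * X]eq_bigr do rewrite exchange_big /=.
have -> : \sum_x \sum_y \sum_z X x * Y y * psi ((1 + x + y) * z) =
    \sum_x q * (X x * Y (-1 - x)).
  apply: eq_bigr => x _; under eq_bigr do rewrite -mulr_sumr sum_psi.
  rewrite (bigD1 (-1 - x)) //=.
  have -> : 1 + x + (-1 - x) = 0 by ring.
  rewrite eqxx mulrC big1 ?addr0 // => y yx.
  case: eqP => [e|_]; last by rewrite mulr0.
  case/eqP: yx; rewrite -[y]addr0 -{1}oppr0 -e; ring.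
rewrite -mulr_sumr [RHS]mulrCA; congr (_ * _); rewrite sum_opp mulr_sumr.
apply: eq_bigr => x _.
have -> : Y (-1 - - x) = Y (-1) * Y (1 - x) by rewrite -(mcM _ _ hY); congr Y; ring.
have -> : X (- x) = X (-1) * X x by rewrite -(mcM _ _ hX) mulN1r.
have X1 := mcN1_sqr hX; have Y1 := mcN1_sqr hY.
have -> : X (-1) * Y (-1) * (X (-1) * X x * (Y (-1) * Y (1 - x))) =
  (X (-1) * X (-1)) * (Y (-1) * Y (-1)) * (X x * Y (1 - x)) by ring.
by rewrite X1 Y1 !mul1r.
Qed.

Lemma jacobi_neq0 X Y : mulchar X -> mulchar Y -> nontriv X \/ nontriv Y ->
  jacobi X Y != 0.
Proof.
move=> hX hY nXY; have : q * jacobi X Y != 0.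
  have N1 : (-1 : F) != 0 by rewrite oppr_eq0 oner_eq0.
  rewrite jacobi_gauss // !mulf_neq0 ?gauss_neq0 ?mc_neq0 //.
  exact/mc_cbar/mc_cmul.
by apply: contra_neq => ->; rewrite mulr0.
Qed.

Lemma sum_fiber (h : F -> F) (f : F -> algC) :
  \sum_x f (h x) = \sum_w (\sum_(x | h x == w) 1) * f w.
Proof.
rewrite (partition_big h xpredT) //=; apply: eq_bigr => w _.
by rewrite mulr_suml; apply: eq_bigr => x /eqP->; rewrite mul1r.
Qed.

Hypothesis oddF : odd #|F|.

Lemma four_neq0 : (4%:R : F) != 0.
Proof. by rewrite (natrM _ 2 2) mulf_neq0 ?two_neq0. Qed.

(** The equation [x (1 - x) = w] has [1 + phi (1 - 4 w)] solutions, and the constant 1 drops out by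
    orthogonality. *)
Lemma jacobi_self D : mulchar D -> nontriv D ->
  jacobi D D = (D 4%:R)^-1 * jacobi D qphi.
Proof.
move=> hD nD; rewrite /jacobi.
under eq_bigr do rewrite -mcM //.
rewrite (sum_fiber (fun x => x * (1 - x)) D).
rewrite (eq_bigr (fun w => D w + D w * qphi (1 - 4%:R * w))); last first.
  move=> w _; rewrite (eq_bigl (fun x => 1 * x ^+ 2 + (-1) * x + w == 0)) => [|x].
    by rewrite card_quad ?oner_eq0 // sqrrN expr1n mulr1 mulrDl mul1r mulrC.
  by rewrite -subr_eq0 -oppr_eq0; congr (_ == 0); ring.
rewrite big_split /= sum_nontriv // add0r (sum_scale _ (invr_neq0 four_neq0)).
rewrite mulr_sumr; apply: eq_bigr => w _.
by rewrite mulVKf ?four_neq0 // mcM // mcV // mulrA.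
Qed.

Lemma gauss_qphi_sqr : gauss (@qphi F) * gauss (@qphi F) = qphi (-1 : F) * q.
Proof.
have hp := mc_qphi oddF.
rewrite -gauss_conj //; last exact: qphi_nontriv.
congr (_ * gauss _); apply: functional_extensionality => x.
by rewrite /cbar mc_conj // qphiV.
Qed.

(** For nontrivial [D], [jacobi_self] at the conjugate of [D] is rewritten in Gauss sums; the
    conjugation puts the third Gauss sums of its two sides at [D^2] and at [phi D]. *)
Lemma hasse_davenport2 D : mulchar D ->
  D 4%:R * gauss D * gauss (cmul qphi D) = gauss (cexp D 2) * gauss (@qphi F).
Proof.
move=> hD; have hp := mc_qphi oddF; have np := qphi_nontriv oddF.
have hD2 : mulchar (cexp D 2) by apply: mc_cexp.
have hpD := mc_cmul hp hD.
case: (trivVnontriv hD) => [tD|nD].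
  have e4 : eps (4%:R : F) = 1 by rewrite /eps (negbTE four_neq0).
  have -> : cexp D 2 = eps.
    by apply: functional_extensionality => x; rewrite /cexp tD /eps; case: eqP; rewrite ?expr0n ?expr1n.
  have -> : cmul qphi D = qphi.
    apply: functional_extensionality => x; rewrite /cmul tD /eps.
    by case: eqP => [->|]; rewrite ?(mc0 hp) ?mulr0 ?mulr1.
  by rewrite (is_trivE tD) e4 mul1r.
have hb := mc_cbar hD; have nb := nontriv_cbar hD nD.
have D40 := mc_neq0 hD four_neq0.
have := congr1 ( *%R q) (jacobi_self hb nb).
rewrite jacobi_gauss //; last by left.
rewrite mulrCA jacobi_gauss //; last by left.
have -> : cbar (cmul (cbar D) (cbar D)) = cexp D 2.
  by apply: functional_extensionality => x; rewrite /cbar /cmul /cexp rmorphM /= conjCK.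
have -> : cbar (cmul (cbar D) qphi) = cmul qphi D.
  apply: functional_extensionality => x; rewrite /cbar /cmul rmorphM /= conjCK mulrC.
  by rewrite (mc_conj _ hp) qphiV.
rewrite (mcN1_sqr hb) mul1r /cbar !mc_conj // invrK -/(cbar D).
rewrite mcN1V // => e; have gg := gauss_conj hD nD; have pp := gauss_qphi_sqr.
have gb0 := gauss_neq0 hb; have gp0 := gauss_neq0 hp.
apply: (mulfI (mulf_neq0 (mulf_neq0 gb0 gb0) gp0)); symmetry.
have -> : gauss (cbar D) * gauss (cbar D) * gauss (@qphi F) * (gauss (cexp D 2) * gauss (@qphi F))
  = (gauss (cbar D) * gauss (cbar D) * gauss (cexp D 2)) * (gauss (@qphi F) * gauss (@qphi F)) by ring.
rewrite e pp.
have -> : gauss (cbar D) * gauss (cbar D) * gauss (@qphi F) * (D 4%:R * gauss D * gauss (cmul qphi D))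
  = (gauss D * gauss (cbar D)) * gauss (cbar D) * gauss (@qphi F) * (D 4%:R * gauss (cmul qphi D)) by ring.
rewrite gg.
transitivity ((qphi (-1 : F) * qphi (-1 : F)) *
  (D 4%:R * (D (-1) * gauss (cbar D) * gauss (@qphi F) * gauss (cmul qphi D)) * q)).
  by ring.
by rewrite mcN1_sqr // mul1r; ring.
Qed.

End GaussJacobi.

(** * The cubic Hasse-Davenport relation *)

Section CubicHasseDavenport.
Variable F : finFieldType.
Hypotheses (oddF : odd #|F|) (F3 : (#|F| %% 3 = 1)%N).
Variable eta : cfn F.
Hypotheses (heta : mulchar eta) (eta3 : is_triv (cexp eta 3)) (neta : nontriv eta).
Implicit Types (x y z v w s m p : F).
Local Notation q := (#|F|%:R : algC).

Lemma three_neq0 : (3%:R : F) != 0.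
Proof. by apply: natr_coprime_neq0; rewrite /coprime -gcdn_modr F3. Qed.

Lemma cbrt1 : exists w : F, w ^+ 2 + w + 1 = 0.
Proof.
have [u u0 [gen uinj]] := gen_unit F.
have [k qk] : exists k, #|F|.-1 = (k * 3)%N.
  by apply/dvdnP; rewrite -subn1 -eqn_mod_dvd ?F3 // ltnW // finNzRing_gt1.
have q_gt0 : (0 < #|F|.-1)%N by rewrite -subn1 subn_gt0 finNzRing_gt1.
have k_gt0 : (0 < k)%N by move: q_gt0; rewrite qk muln_gt0 => /andP[].
have w3 : (u ^+ k) ^+ 3 = 1.
  apply: (mulfI u0); rewrite -exprM -qk -exprS prednK ?expf_card ?mulr1 //.
  exact: ltnW (finNzRing_gt1 F).
have w1 : u ^+ k != 1.
  apply/eqP; rewrite -(expr0 u) => /uinj; rewrite mod0n modn_small.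
    by move=> k0; rewrite k0 in k_gt0.
  by rewrite qk -{1}[k]muln1 ltn_pmul2l.
move: (u ^+ k) w3 w1 => w w3 w1; exists w.
apply: (mulfI (_ : w - 1 != 0)); first by rewrite subr_eq0.
have e : (w - 1) * (w ^+ 2 + w + 1) = w ^+ 3 - 1 by ring.
by rewrite e w3 subrr mulr0.
Qed.

Lemma eta_cube x : x != 0 -> eta x ^+ 3 = 1.
Proof. by move=> x0; have := eta3 x; rewrite /cexp /eps (negbTE x0). Qed.

Lemma card_cbrt x : x != 0 -> \sum_(y : F | y ^+ 3 == x) 1 = 1 + eta x + (eta x)^-1.
Proof.
move=> x0; have ex0 := mc_neq0 heta x0.
case: (boolP [exists y : F, y ^+ 3 == x]) => [/existsP[z /eqP zx]|nex].
  have z0 : z != 0 by apply: contra_neq x0 => z0; rewrite -zx z0 expr0n.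
  have [w w2] := cbrt1; have t0 := three_neq0.
  have w1 : w != 1 by apply: contra_neq t0 => w1; rewrite -w2 w1; ring.
  have w0 : w != 0 by apply: contra_eq_neq w2 => ->; rewrite expr0n !add0r oner_eq0.
  have fac y : y ^+ 3 - z ^+ 3 = (y - z) * ((y - w * z) * (y - w ^+ 2 * z)).
    have e : (y - z) * ((y - w * z) * (y - w ^+ 2 * z)) - (y ^+ 3 - z ^+ 3) =
      (w ^+ 2 + w + 1) * (- y ^+ 2 * z + y * z ^+ 2 * w - z ^+ 3 * (w - 1)) by ring.
    by apply/esym/eqP; rewrite -subr_eq0 e w2 mul0r.
  rewrite -zx mcX // eta_cube // invr1.
  rewrite (eq_bigl (fun y => [|| y == z, y == w * z | y == w ^+ 2 * z])); last first.
    by move=> y; rewrite -subr_eq0 fac !mulf_eq0 !subr_eq0.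
  have wz : w * z != z by rewrite -{2}[z]mul1r (inj_eq (mulIf z0)).
  have w2z : w ^+ 2 * z != z.
    rewrite -{2}[z]mul1r (inj_eq (mulIf z0)); apply: contra_neq w1 => w21.
    have : 2%:R + w = 0 by rewrite -w2 w21; ring.
    have e3 : (3%:R : F) = (2%:R - w) * (2%:R + w) + (w ^+ 2 - 1) by ring.
    by move=> e; case/eqP: t0; rewrite e3 e w21 subrr mulr0 addr0.
  have w2w : w ^+ 2 * z != w * z.
    by rewrite (inj_eq (mulIf z0)) expr2 -{3}[w]mulr1 (inj_eq (mulfI w0)).
  rewrite (bigD1 z) ?eqxx //= (bigD1 (w * z)) /=; last by rewrite eqxx orbT wz.
  rewrite (big_pred1 (w ^+ 2 * z)) ?addrA // => y /=.
  case: (eqVneq y z) => [->|_] /=; first by rewrite eq_sym (negbTE w2z).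
  by case: (eqVneq y (w * z)) => [->|_] /=; rewrite ?andbF ?andbT // eq_sym (negbTE w2w).
rewrite big_pred0; last by move=> y; apply/negP => h; case/existsP: nex; exists y.
(* A cube root of unity [e] other than 1 satisfies [1 + e + e^-1 = 0]. It remains to see that [eta]
   is 1 only at cubes, which holds because [eta] is primitive of order 3 on a generator. *)
suff e1 : eta x != 1.
  have t3 := eta_cube x0; apply/esym; apply: (mulfI (_ : (eta x - 1) * eta x != 0)).
    by rewrite mulf_neq0 // subr_eq0.
  have e : (eta x - 1) * eta x * (1 + eta x + (eta x)^-1) = eta x ^+ 3 - 1 by field.
  by rewrite e t3 subrr mulr0.
apply: contra nex => /eqP e1.
have [u u0 [gen uinj]] := gen_unit F.
have eu3 := eta_cube u0.
have eu1 : eta u != 1.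
  case: neta => t t0; apply: contra_neq => eu.
  by have [j ->] := gen _ t0; rewrite mcX // eu expr1n.
have [k xk] := gen _ x0; move: e1; rewrite xk mcX //.
rewrite [X in eta u ^+ X](divn_eq k 3) exprD [(_ * 3)%N]mulnC exprM eu3 expr1n mul1r.
case r: (k %% 3)%N (ltn_mod k 3) => [|[|[|]]] //= _.
- move=> _; apply/existsP; exists (u ^+ (k %/ 3)).
  by rewrite -exprM [X in _ == u ^+ X](divn_eq k 3) r addn0.
- by rewrite expr1 => e; rewrite e eqxx in eu1.
- by move=> e; move: eu3; rewrite exprS e mulr1 => e'; rewrite e' eqxx in eu1.
Qed.

(** Double counting of the [a] with [a^6 - s a^3 + m^3 = 0], fibred once over [v = a + m / a]
    (Cardano's substitution) and once over [y = a^3]. *)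
Lemma card_cubic_quad m s : m != 0 ->
  \sum_(v | v ^+ 3 - 3%:R * m * v == s) (1 + qphi (v ^+ 2 - 4%:R * m)) =
  1 + qphi (s ^+ 2 - 4%:R * m ^+ 3) + 2%:R * \sum_(y | y ^+ 2 - s * y + m ^+ 3 == 0) eta y.
Proof.
move=> m0; have m30 : m ^+ 3 != 0 by rewrite expf_neq0.
transitivity (\sum_(a | (a ^+ 3) ^+ 2 - s * a ^+ 3 + m ^+ 3 == 0) (1 : algC)).
  symmetry; rewrite (partition_big (fun a => a + m / a) (fun v => v ^+ 3 - 3%:R * m * v == s)) /=.
    apply: eq_bigr => v /eqP vs.
    rewrite (eq_bigl (fun a => 1 * a ^+ 2 + (- v) * a + m == 0)).
      by rewrite card_quad ?oner_eq0 // sqrrN mulr1.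
    move=> a; case: (eqVneq (a : F) (0 : F)) => [->|a0].
      have -> : (0 ^+ 3) ^+ 2 - s * 0 ^+ 3 + m ^+ 3 = m ^+ 3 by ring.
      have -> : 1 * 0 ^+ 2 + - v * 0 + m = m by ring.
      by rewrite (negbTE m30) (negbTE m0).
    have -> : (a + m / a == v) = (1 * a ^+ 2 + - v * a + m == 0).
      rewrite -(inj_eq (mulIf a0)) -subr_eq0; congr (_ == 0).
      by field.
    case: (boolP (1 * a ^+ 2 + - v * a + m == 0)) => [/eqP e|_]; rewrite ?andbF ?andbT //.
    have hm : m = v * a - a ^+ 2 by rewrite -[v * a - _]addr0 -e; ring.
    by apply/eqP; rewrite -vs hm; ring.
  move=> a /eqP ha; have a0 : a != 0.
    by apply: contra_neq m30 => a0; rewrite -ha a0; ring.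
  rewrite -subr_eq0; apply/eqP; apply: (mulIf (expf_neq0 3 a0)); rewrite mul0r -ha.
  by field.
rewrite (partition_big (fun a => a ^+ 3) (fun y => y ^+ 2 - s * y + m ^+ 3 == 0)) //=.
rewrite (eq_bigr (fun y => 1 + eta y + (eta y)^-1)); last first.
  move=> y hy; have y0 : y != 0.
    by apply: contra_neq m30 => y0; rewrite -(eqP hy) y0; ring.
  rewrite -card_cbrt //; apply: eq_bigl => a.
  by case: (eqVneq (a ^+ 3) y) => [->|]; rewrite ?andbF ?andbT ?hy.
rewrite !big_split /= [2%:R * _]mulr_natl mulr2n addrA; congr (_ + _ + _).
  rewrite (eq_bigl (fun y => 1 * y ^+ 2 + (- s) * y + m ^+ 3 == 0)).
    by rewrite card_quad ?oner_eq0 // sqrrN mulr1.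
  by move=> y; rewrite mul1r mulNr.
(* The involution [y -> m^3 / y] preserves the quadratic and inverts [eta], which is trivial on
   cubes; so the two twisted sums coincide. *)
have inj : injective (fun y => m ^+ 3 / y) by move=> y z /(mulfI m30)/invr_inj.
rewrite (reindex_inj inj) /=; apply: eq_big => [y|y _].
  case: (eqVneq y 0) => [->|y0].
    by rewrite !(invr0, mulr0).
  rewrite -(inj_eq (mulIf (mulf_neq0 y0 y0))) mul0r -[RHS](inj_eq (mulfI m30)) mulr0.
  by congr (_ == 0); field.
by rewrite mcD // mcX // eta_cube // mul1r invrK.
Qed.

(** Up to a square the two discriminants agree, so [phi (v^2 - 4 m)] is the same for all roots [v]
    when [s^2 - 4 m^3] is nonzero. *)
Lemma cubic_disc m v : (v ^+ 3 - 3%:R * m * v) ^+ 2 - 4%:R * m ^+ 3 =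
  (v ^+ 2 - 4%:R * m) * (v ^+ 2 - m) ^+ 2.
Proof. by ring. Qed.

(* When the discriminant [s^2 - 4 m^3] is a nonsquare, only the bound "at most
   one root" is immediate; equality holds because both sides sum to [q] over [s]. *)
Lemma card_cubic m s : m != 0 ->
  \sum_(v | v ^+ 3 - 3%:R * m * v == s) 1 =
  1 + \sum_(y | y ^+ 2 - s * y + m ^+ 3 == 0) eta y.
Proof.
move=> m0; have hp := mc_qphi oddF.
pose n s : algC := \sum_(v | v ^+ 3 - 3%:R * m * v == s) 1.
pose k s : algC := \sum_(y | y ^+ 2 - s * y + m ^+ 3 == 0) eta y.
have two0 : (2%:R : algC) != 0 by rewrite (eqr_nat _ 2 0).
have nn' r : r ^+ 2 - 4%:R * m ^+ 3 != 0 ->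
    n r * (1 + qphi (r ^+ 2 - 4%:R * m ^+ 3)) = 1 + qphi (r ^+ 2 - 4%:R * m ^+ 3) + 2%:R * k r.
  move=> d0; rewrite -card_cubic_quad // mulr_suml; apply: eq_bigr => v /eqP vr.
  rewrite mul1r -vr cubic_disc (mcM _ _ hp) qphiX2 ?mulr1 //.
  by apply: contra_neq d0 => d0; rewrite -vr cubic_disc d0 expr0n mulr0.
have T_ge0 r : 0 <= 1 + k r - n r.
  case: (eqVneq (r ^+ 2 - 4%:R * m ^+ 3) 0) => [d0|d0].
    (* Zero discriminant: [m = mu^2] and [r = 2 mu^3], so the cubic is [(v - 2 mu) (v + mu)^2], with
       two distinct roots as [3 <> 0], and the quadratic has the single root [mu^3], where [eta] is
       1. *)
    pose mu := r / (2%:R * m); have t0 := two_neq0 oddF.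
    have rmu : r = 2%:R * m * mu by rewrite /mu mulrC divfK // mulf_neq0.
    have mmu : m = mu ^+ 2.
      apply: (mulfI (mulf_neq0 (four_neq0 oddF) (expf_neq0 2 m0))).
      apply/eqP; rewrite -subr_eq0 -oppr_eq0 -d0 rmu; apply/eqP; ring.
    have mu0 : mu != 0 by apply: contra_neq m0 => mu0; rewrite mmu mu0 expr0n.
    have -> : k r = 1.
      rewrite /k (big_pred1 (mu ^+ 3)) ?mcX ?eta_cube // => y /=.
      rewrite (_ : _ + _ = (y - mu ^+ 3) ^+ 2) ?expf_eq0 /= ?subr_eq0 //.
      by rewrite rmu mmu; ring.
    have -> : n r = 2%:R.
      rewrite /n (eq_bigl (fun v => (v == 2%:R * mu) || (v == - mu))); last first.
        move=> v; rewrite -subr_eq0 -[v == - mu]subr_eq0 opprK -[v == 2%:R * mu]subr_eq0.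
        rewrite (_ : _ - r = (v - 2%:R * mu) * (v + mu) ^+ 2); last by rewrite rmu mmu; ring.
        by rewrite mulf_eq0 expf_eq0.
      have ne : - mu != 2%:R * mu.
        rewrite -subr_eq0 (_ : _ - _ = - (3%:R * mu)); last by ring.
        by rewrite oppr_eq0 mulf_neq0 ?three_neq0.
      rewrite (bigD1 (2%:R * mu)) ?eqxx //= (big_pred1 (- mu)) // => v /=.
      by case: (eqVneq v (2%:R * mu)) => [->|] /=; rewrite ?andbT // eq_sym (negbTE ne).
    by rewrite subr_ge0.
  have := nn' _ d0; move: (d0); rewrite /qphi (negbTE d0).
  case: existsP => [_ _|nsq _].
    move=> e; suff -> : n r = 1 + k r by rewrite subrr.
    by apply: (mulIf two0); rewrite -[2%:R]/(1 + 1) e; ring.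
  rewrite subrr mulr0 add0r => /esym/eqP; rewrite mulf_eq0 (negbTE two0) /= => /eqP ->.
  rewrite addr0 subr_ge0 /n; case: (pickP (fun v => v ^+ 3 - 3%:R * m * v == r)) => [v hv|h0]; last first.
    by rewrite big_pred0.
  rewrite (big_pred1 v) // => z /=; apply/idP/eqP => [hz|-> //].
  apply/eqP; apply: contraT => zv; case: nsq.
  (* Two distinct roots [v], [z] determine [m], and then [v^2 - 4 m = -(v + 2 z)^2 / 3]. This is a
     square, since [2 w + 1] is a square root of [-3] for a primitive cube root of unity [w]; so the
     discriminant would be a square too. *)
  have hm : 3%:R * m = v ^+ 2 + v * z + z ^+ 2.
    have zv0 : z - v != 0 by rewrite subr_eq0.
    apply: (mulfI zv0); apply/eqP; rewrite -subr_eq0; apply/eqP.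
    transitivity ((v ^+ 3 - 3%:R * m * v) - (z ^+ 3 - 3%:R * m * z)); first by ring.
    by rewrite (eqP hv) (eqP hz) subrr.
  have [w w2] := cbrt1; have t0 := three_neq0.
  have w3 : (2%:R * w + 1) ^+ 2 = - 3%:R.
    by transitivity (4%:R * (w ^+ 2 + w + 1) - 3%:R); [ring|rewrite w2 mulr0 add0r].
  exists ((2%:R * w + 1) * (v + 2%:R * z) / 3%:R * (v ^+ 2 - m)).
  rewrite -(eqP hv) cubic_disc; apply/eqP; rewrite [LHS]exprMn; congr (_ * _).
  rewrite !exprMn w3.
  have -> : m = (v ^+ 2 + v * z + z ^+ 2) / 3%:R by rewrite -hm mulrC mulKf.
  by field.
have := psumr_eq0P (P := xpredT) (fun r _ => T_ge0 r).
(* The counts [n] add up to [q], and each [y <> 0] solves the quadratic for exactly one [r], so the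
   [k] add up to the sum of [eta], which is 0. *)
have -> : \sum_r (1 + k r - n r) = 0.
  rewrite sumrB big_split /= /n.
  have := sum_fiber (fun v : F => v ^+ 3 - 3%:R * m * v) (fun=> 1).
  under [X in _ = X -> _]eq_bigr do rewrite mulr1.
  move=> <-; rewrite addrAC subrr add0r /k.
  rewrite (eq_bigr (fun r => \sum_y if y ^+ 2 - r * y + m ^+ 3 == 0 then eta y else 0)); last first.
    by move=> r _; rewrite big_mkcond.
  rewrite exchange_big /= -[RHS](sum_nontriv heta neta); apply: eq_bigr => y _.
  case: (eqVneq y 0) => [->|y0]; first by rewrite mc0 // big1 // => r _; case: ifP.
  rewrite -big_mkcond (big_pred1 (y + m ^+ 3 / y)) // => r /=.
  rewrite -[RHS]subr_eq0 -[RHS]oppr_eq0 -[RHS](inj_eq (mulIf y0)) mul0r; congr (_ == 0).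
  by field.
by move=> /(_ erefl s isT)/eqP; rewrite subr_eq0 => /eqP e; exact: esym e.
Qed.

(** A cubic Airy sum is a Kloosterman sum twisted by [eta]: the root count is summed against
    [psi (c * s)], which kills its constant term. *)
Lemma cubic_kloosterman m c : m != 0 -> c != 0 ->
  \sum_v psi (c * (v ^+ 3 - 3%:R * m * v)) = \sum_y eta y * psi (c * (y + m ^+ 3 / y)).
Proof.
move=> m0 c0; rewrite (sum_fiber (fun v => v ^+ 3 - 3%:R * m * v) (fun s => psi (c * s))).
rewrite (eq_bigr (fun s => psi (c * s) +
   \sum_y if y ^+ 2 - s * y + m ^+ 3 == 0 then eta y * psi (c * s) else 0)); last first.
  by move=> s _; rewrite card_cubic // mulrDl mul1r mulr_suml -big_mkcond.
rewrite big_split /= sum_psi (negbTE c0) add0r exchange_big /=; apply: eq_bigr => y _.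
case: (eqVneq y 0) => [->|y0].
  by rewrite mc0 // mul0r big1 // => s _; rewrite mul0r; case: ifP.
rewrite -big_mkcond (big_pred1 (y + m ^+ 3 / y)) // => r /=.
rewrite -[RHS]subr_eq0 -[RHS]oppr_eq0 -[RHS](inj_eq (mulIf y0)) mul0r; congr (_ == 0).
by field.
Qed.

(** The factor [q] stands for [gauss eta * gauss (cbar eta)], as [eta (-1) = 1]. The twisted Gauss
    sums become an exponential sum whose phase is linear in [1 / p]; multiplied by [gauss X] and
    summed over [p], it forces [t = - v^3]. *)
Lemma hasse_davenport3 (X : cfn F) : mulchar X ->
  X 27%:R * (gauss X * gauss (cmul X eta) * gauss (cmul X (cbar eta))) =
  q * gauss (cexp X 3).
Proof.
move=> hX; have hb := mc_cbar heta.
have step1 : gauss (cmul X eta) * gauss (cmul X (cbar eta)) =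
    \sum_p X p * \sum_v psi (p^-1 * v ^+ 3 - 3%:R * v).
  rewrite mulrC !gaussE; try exact: mc_cmul.
  rewrite mulr_suml.
  (* Here [p] is the product of the two summation variables, and [eta^-2 = eta] merges the two
     twists. *)
  rewrite (eq_bigr (fun y => \sum_p X p * (eta p * (eta y * psi (y + p / y))))); last first.
    move=> y _; case: (eqVneq y 0) => [->|y0].
      by rewrite /cmul mc0 // !mul0r big1 // => p _; rewrite (mc0 heta) !(mul0r, mulr0).
    rewrite (sum_scale _ (invr_neq0 y0)) mulr_sumr; apply: eq_bigr => p _.
    rewrite /cmul /cbar mc_conj // !(mcM _ _ hX) !(mcM _ _ heta) !mcV // psiD [p / y]mulrC.
    have := eta_cube y0; have := mc_neq0 hX y0; have := mc_neq0 heta y0.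
    move: (eta y) (X y) => e f e0 f0 e3.
    have -> : X p * (eta p * (e * (psi y * psi (y^-1 * p)))) =
       e ^+ 3 * (X p * (eta p * (e^-1 ^+ 2 * (psi y * psi (y^-1 * p))))) by field.
    by rewrite e3; field; rewrite e0.
  rewrite exchange_big /=; apply: eq_bigr => p _; rewrite -mulr_sumr.
  case: (eqVneq p 0) => [->|p0]; first by rewrite mc0 // !mul0r.
  congr (_ * _); rewrite -mulr_sumr.
  (* The Airy-Kloosterman identity is used with [m = p] and [c = p^-1]. *)
  transitivity (\sum_v psi (p^-1 * (v ^+ 3 - 3%:R * p * v))); last first.
    by apply: eq_bigr => v _; congr psi; field.
  rewrite cubic_kloosterman ?invr_neq0 // [RHS](sum_scale _ p0) mulr_sumr.
  apply: eq_bigr => y _; rewrite (mcM _ _ heta) -mulrA; congr (_ * (_ * psi _)).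
  case: (eqVneq y 0) => [->|y0]; first by rewrite !(mulr0, invr0, addr0).
  by field; rewrite ?p0 ?y0.
rewrite -mulrA step1 mulr_sumr.
rewrite (eq_bigr (fun p => eps p * \sum_t \sum_v X t * psi ((t + v ^+ 3) * p^-1 - 3%:R * v))); last first.
  move=> p _; rewrite /eps; case: (eqVneq p 0) => [->|p0]; first by rewrite mc0 // !(mul0r, mulr0).
  have -> : gauss X * (X p * \sum_v psi (p^-1 * v ^+ 3 - 3%:R * v)) =
     ((X p^-1)^-1 * gauss X) * \sum_v psi (p^-1 * v ^+ 3 - 3%:R * v).
    by rewrite mcV // invrK; ring.
  rewrite -gauss_scale ?invr_neq0 // mulr_suml mul1r; apply: eq_bigr => t _.
  rewrite mulr_sumr; apply: eq_bigr => v _; rewrite -mulrA -psiD.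
  by congr (_ * psi _); ring.
rewrite sum_inv.
rewrite (eq_bigr (fun p => eps p * \sum_t \sum_v X t * psi ((t + v ^+ 3) * p - 3%:R * v))); last first.
  by move=> p _; rewrite invrK /eps invr_eq0.
rewrite sum_eps [X in _ - X](_ : _ = 0) ?subr0; last first.
  apply: big1 => t _; rewrite -mulr_sumr.
  under eq_bigr do rewrite mulr0 add0r -mulNr.
  by rewrite sum_psi oppr_eq0 (negbTE three_neq0) mulr0.
have -> : \sum_p \sum_t \sum_v X t * psi ((t + v ^+ 3) * p - 3%:R * v) =
   q * \sum_v X (- v ^+ 3) * psi (- (3%:R * v)).
  rewrite exchange_big /=; under eq_bigr do rewrite exchange_big /=.
  rewrite exchange_big mulr_sumr /=; apply: eq_bigr => v _.
  under eq_bigr do under eq_bigr do rewrite psiD mulrA.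
  under eq_bigr do rewrite -mulr_suml -mulr_sumr sum_psi.
  rewrite -mulr_suml mulrA; congr (_ * _).
  rewrite (bigD1 (- v ^+ 3)) //= addNr eqxx mulrC big1 ?addr0 // => t tv.
  by rewrite -[v ^+ 3]opprK subr_eq0 (negbTE tv) mulr0.
rewrite mulrCA; congr (_ * _).
have hX3 : mulchar (cexp X 3) by apply: mc_cexp.
have X3 : X 27%:R = cexp X 3 3%:R by rewrite /cexp -mcX // -natrX.
rewrite X3 -[RHS](mulVKf (mc_neq0 hX3 three_neq0)) -gauss_scale ?three_neq0 //.
rewrite sum_opp; congr (_ * _); apply: eq_bigr => v _.
by rewrite /cexp -(mcX v 3 hX); congr (_ * _); [congr X | congr psi]; ring.
Qed.

End CubicHasseDavenport.

Ltac mcs := repeat first [ assumption | apply: mc_ch | apply: mc_eps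
  | apply: mc_cmul | apply: mc_cbar | apply: mc_cexp ].

(** * Fourier expansion of hypergeometric sums *)

Section HypergeometricExpansion.
Variable F : finFieldType.
Implicit Types (x y z l : F) (X Y N D E A B : cfn F).
Local Notation q := (#|F|%:R : algC).

(** The Gauss sum at [cmul (cbar X) B] is common to both Jacobi sums and cancels; the rest is the
    analogue of the Pochhammer quotient [(X)_n / (B)_n]. *)
Lemma jacobi_ratio X B N : mulchar X -> mulchar B -> mulchar N ->
  nontriv (cmul (cbar X) B) ->
  jacobi (cmul X N) (cmul (cbar X) B) =
  N (-1) * gauss (cmul X N) * gauss (cbar (cmul B N)) / (gauss X * gauss (cbar B))
   * jacobi X (cmul (cbar X) B).
Proof.
move=> hX hB hN nE; set E := cmul (cbar X) B.
have hE : mulchar E by mcs.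
have hXN : mulchar (cmul X N) by mcs.
have j1 := jacobi_gauss hXN hE (or_intror nE).
have j2 := jacobi_gauss hX hE (or_intror nE).
have e1 : cmul (cmul X N) E = cmul B N.
  apply: cfn_ext; [mcs|mcs|] => z z0; rewrite /E /cmul cbarE //.
  by field; apply: mc_neq0.
have e2 : cmul X E = B.
  apply: cfn_ext; [mcs|mcs|] => z z0; rewrite /E /cmul cbarE //.
  by field; apply: mc_neq0.
rewrite e1 in j1; rewrite e2 in j2.
have gX := gauss_neq0 hX; have gB := gauss_neq0 (mc_cbar hB).
apply: (mulfI (card_neq0 F)); rewrite j1 [RHS]mulrCA j2 {1}/cmul.
by field; rewrite gX gB.
Qed.

(** Scaling [l] by [1 / (y z)] separates the three variables. *)
Lemma mellin_P32 A1 A2 A3 B1 B2 N :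
  mulchar A1 -> mulchar A2 -> mulchar A3 -> mulchar B1 -> mulchar B2 -> mulchar N ->
  \sum_l cbar N l * P32 A1 A2 A3 B1 B2 l =
  jacobi (cbar N) (cbar A1) * jacobi (cmul A2 N) (cmul (cbar A2) B1)
   * jacobi (cmul A3 N) (cmul (cbar A3) B2).
Proof.
move=> h1 h2 h3 hB1 hB2 hN; have hNb : mulchar (cbar N) by mcs.
rewrite /P32; under eq_bigr do rewrite mulr_sumr.
rewrite exchange_big /= /jacobi mulr_sumr; apply: eq_bigr => y _.
case: (eqVneq y 0) => [->|y0].
  have -> : cmul A3 N 0 = 0 by rewrite /cmul (mc0 h3) mul0r.
  by rewrite mul0r mulr0 big1 // => l _; rewrite (mc0 h3) !(mul0r, mulr0).
rewrite /P21.
transitivity (\sum_l \sum_z cbar N l * (A3 y * cmul (cbar A3) B2 (1 - y)) *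
   (A2 z * cmul (cbar A2) B1 (1 - z) * cbar A1 (1 - l * y * z))).
  by apply: eq_bigr => l _; rewrite mulrA mulr_sumr.
rewrite exchange_big /= mulrAC mulr_sumr; apply: eq_bigr => z _.
case: (eqVneq z 0) => [->|z0].
  have -> : cmul A2 N 0 = 0 by rewrite /cmul (mc0 h2) mul0r.
  by rewrite mul0r mulr0 big1 // => l _; rewrite (mc0 h2) !(mul0r, mulr0).
have yz : (y * z)^-1 != 0 by rewrite invr_eq0 mulf_neq0.
rewrite (sum_scale _ yz) !mulr_suml; apply: eq_bigr => l _.
have -> : 1 - (y * z)^-1 * l * y * z = 1 - l by field; rewrite y0 z0.
rewrite (mcM _ _ hNb) (mcV _ hNb) {1}(cbarE _ hN) invrK (mcM _ _ hN) /cmul.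
by ring.
Qed.

(** The analogue of the power series: [gauss (cbar (ch i))] plays the role of [1 / n!]. Unlike the
    definition of [P32], this form is visibly symmetric in the upper parameters, as the cubic
    relation requires. *)
Lemma F32_expand A1 A2 A3 B1 B2 l :
  mulchar A1 -> mulchar A2 -> mulchar A3 -> mulchar B1 -> mulchar B2 ->
  nontriv A1 -> nontriv (cmul (cbar A2) B1) -> nontriv (cmul (cbar A3) B2) -> l != 0 ->
  (q - 1) * F32 A1 A2 A3 B1 B2 l =
  \sum_(i : mchar F) ch i (- l) * (gauss (cbar (ch i)) *
    (gauss (cmul A1 (ch i)) * gauss (cmul A2 (ch i)) * gauss (cmul A3 (ch i))) *
    (gauss (cbar (cmul B1 (ch i))) * gauss (cbar (cmul B2 (ch i))))) /
    (gauss A1 * gauss A2 * gauss A3 * (gauss (cbar B1) * gauss (cbar B2))).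
Proof.
move=> h1 h2 h3 hB1 hB2 n1 n2 n3 l0; rewrite /F32 mulrA mellin_inv // mulr_suml.
apply: eq_bigr => i _; have hN := mc_ch i; move: (ch i) hN => N hN.
have -> : cmul B1 (cbar A2) = cmul (cbar A2) B1.
  by apply: functional_extensionality => z; rewrite /cmul mulrC.
have -> : cmul B2 (cbar A3) = cmul (cbar A3) B2.
  by apply: functional_extensionality => z; rewrite /cmul mulrC.
rewrite mellin_P32 // !jacobi_ratio //.
have J2 : jacobi A2 (cmul (cbar A2) B1) != 0 by apply: jacobi_neq0; [mcs|mcs|right].
have J3 : jacobi A3 (cmul (cbar A3) B2) != 0 by apply: jacobi_neq0; [mcs|mcs|right].
have g1 := gauss_neq0 h1; have g2 := gauss_neq0 h2; have g3 := gauss_neq0 h3.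
have gB1 := gauss_neq0 (mc_cbar hB1); have gB2 := gauss_neq0 (mc_cbar hB2).
have -> : jacobi (cbar N) (cbar A1) = N (-1) * gauss (cbar N) * gauss (cmul A1 N) / gauss A1.
  apply: (mulfI (card_neq0 F)); rewrite jacobi_gauss; [|mcs|mcs|by right; apply: nontriv_cbar].
  have -> : cbar (cmul (cbar N) (cbar A1)) = cmul A1 N.
    by apply: functional_extensionality => z; rewrite /cmul /cbar rmorphM /= !conjCK mulrC.
  rewrite !cbarE // !mcN1V //.
  have gc := gauss_conj h1 n1.
  have -> : gauss (cbar A1) = A1 (-1) * q / gauss A1 by rewrite -gc; field.
  have -> : N (-1) * A1 (-1) * gauss (cbar N) * (A1 (-1) * q / gauss A1) * gauss (cmul A1 N)
    = (A1 (-1) * A1 (-1)) * (q * (N (-1) * gauss (cbar N) * gauss (cmul A1 N) / gauss A1)) by field.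
  by rewrite mcN1_sqr // mul1r.
rewrite -[- l]mulN1r (mcM (-1) _ hN).
have n2' := mcN1_sqr hN.
transitivity (N (-1) * N (-1) * (N (-1) * N l * (gauss (cbar N) *
    (gauss (cmul A1 N) * gauss (cmul A2 N) * gauss (cmul A3 N)) *
    (gauss (cbar (cmul B1 N)) * gauss (cbar (cmul B2 N)))) /
    (gauss A1 * gauss A2 * gauss A3 * (gauss (cbar B1) * gauss (cbar B2))))).
  by field; rewrite g1 g2 g3 gB1 gB2 J2 J3.
by rewrite n2' mul1r.
Qed.

Lemma F32_0 A1 A2 A3 B1 B2 :
  mulchar A1 -> mulchar A2 -> mulchar A3 -> mulchar B1 -> mulchar B2 ->
  nontriv (cmul (cbar A2) B1) -> nontriv (cmul (cbar A3) B2) ->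
  F32 A1 A2 A3 B1 B2 0 = 1.
Proof.
move=> h1 h2 h3 hB1 hB2 n2 n3; rewrite /F32.
have -> : cmul B1 (cbar A2) = cmul (cbar A2) B1.
  by apply: functional_extensionality => z; rewrite /cmul mulrC.
have -> : cmul B2 (cbar A3) = cmul (cbar A3) B2.
  by apply: functional_extensionality => z; rewrite /cmul mulrC.
have J2 : jacobi A2 (cmul (cbar A2) B1) != 0 by apply: jacobi_neq0; [mcs|mcs|right].
have J3 : jacobi A3 (cmul (cbar A3) B2) != 0 by apply: jacobi_neq0; [mcs|mcs|right].
suff -> : P32 A1 A2 A3 B1 B2 0 = jacobi A2 (cmul (cbar A2) B1) * jacobi A3 (cmul (cbar A3) B2).
  by rewrite divff // mulf_neq0.
rewrite /P32 mulrC /jacobi mulr_suml; apply: eq_bigr => y _; congr (_ * _).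
rewrite /P21; apply: eq_bigr => z _.
by rewrite !mul0r subr0 (mc1 (mc_cbar h1)) mulr1.
Qed.

(** The right side is a twisted hyper-Kloosterman sum in [t]; putting [v = r s v'] splits its Mellin
    transform into three Gauss sums. *)
Lemma gauss_triple_sum (X Y : cfn F) t : mulchar X -> mulchar Y -> t != 0 ->
  \sum_(i : mchar F) ch i t * (gauss (cbar (ch i)) * gauss (cmul X (cbar (ch i)))
     * gauss (cmul Y (cbar (ch i)))) =
  (q - 1) * \sum_r \sum_s X r * Y s * psi (r + s + t / (r * s)).
Proof.
move=> hX hY t0; pose f v : algC := \sum_r \sum_s X r * Y s * psi (r + s + v / (r * s)).
rewrite -[RHS]/((q - 1) * f t) mellin_inv //; apply: eq_bigr => i _; congr (_ * _).
have := mc_ch i; move: (ch i) => N hN.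
have hXN : mulchar (cmul X (cbar N)) by mcs.
have hYN : mulchar (cmul Y (cbar N)) by mcs.
have hNb : mulchar (cbar N) by mcs.
rewrite /f; under [RHS]eq_bigr do rewrite mulr_sumr.
rewrite exchange_big /= -mulrA mulrC (gaussE hXN) !mulr_suml; apply: eq_bigr => r _.
case: (eqVneq r 0) => [->|r0].
  rewrite (mc0 hXN) !mul0r big1 // => v _; rewrite big1 ?mulr0 // => s _.
  by rewrite (mc0 hX) !mul0r.
under [RHS]eq_bigr do rewrite mulr_sumr.
rewrite exchange_big /= (gaussE hYN) mulr_sumr mulr_suml; apply: eq_bigr => s _.
case: (eqVneq s 0) => [->|s0].
  rewrite (mc0 hYN) !(mul0r, mulr0) big1 // => v _.
  by rewrite (mc0 hY) !(mul0r, mulr0).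
rewrite [RHS](sum_scale _ (mulf_neq0 r0 s0)) (gaussE hNb) mulr_sumr; apply: eq_bigr => v _.
have -> : r * s * v / (r * s) = v by field; rewrite r0 s0.
by rewrite !(mcM _ _ hNb) !psiD /cmul; ring.
Qed.

End HypergeometricExpansion.

(** * The cubic transformation *)

Section CubicTransformation.
Variable F : finFieldType.
Hypothesis oddF : odd #|F|.
Implicit Types (x y z r s u V W : F) (N K D : cfn F).
Local Notation q := (#|F|%:R : algC).
Local Notation phi := (@qphi F).
Variables B C : cfn F.
Hypotheses (hB : mulchar B) (hC : mulchar C) (nB : nontriv B) (nC : nontriv C).

Let hphi : mulchar phi := mc_qphi oddF.
Let hBb : mulchar (cbar B) := mc_cbar hB.
Let hCb : mulchar (cbar C) := mc_cbar hC.

(** The value at 0 is the right one: for [a = b = 0] the sum runs over all [s] and vanishes because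
    [C] is nontrivial. *)
Lemma sum_linear_fiber (a b : F) : \sum_(s | a * s == b) cbar C s = C a * cbar C b.
Proof.
case: (eqVneq a 0) => [->|a0].
  rewrite (mc0 hC) mul0r; case: (eqVneq b 0) => [->|b0].
    rewrite -[RHS](sum_nontriv hCb (nontriv_cbar hC nC)).
    by apply: eq_bigl => s; rewrite mul0r eqxx.
  by rewrite big_pred0 // => s; rewrite mul0r eq_sym (negbTE b0).
rewrite (big_pred1 (b / a)) => [|s /=]; last by apply/eqP/eqP => [<-|->]; field.
by rewrite mcD // (cbarE a hC) invrK mulrC.
Qed.

(** The two factors in [C] together are the value of [cbar C] at the variable eliminated through its
    linear equation; the [s] kept here is the argument of [cbar B]. *)
Definition Usum x : algC :=
  \sum_s \sum_V cbar B s * (C (1 + s * (1 - V) ^+ 2) * cbar C (x * V - 1 - s)).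
Definition Ysum x : algC :=
  \sum_s \sum_V cbar B s * (C ((1 - V) ^+ 2 + V ^+ 2 / s) * cbar C (x * V / s - 1)).

(* The quadratic character counts the roots [W] of
   [r s W^2 + x W + (1 + r + s - x)]; the equation is linear in [s]. *)
Lemma quadratic_sum_Usum x :
  \sum_r \sum_s cmul phi (cbar B) r * cmul phi (cbar C) s *
     phi (1 - x + r + s - x ^+ 2 / 4%:R / (r * s)) = phi (-1) * Usum x.
Proof.
have four0 := four_neq0 oddF.
have phi4 : phi 4%:R = 1 by rewrite (natrM _ 2 2) (mcM _ _ hphi) qphi_sqr // two_neq0.
transitivity (phi (-1) * \sum_r cbar B r * \sum_s cbar C s *
   ((\sum_(W | r * s * W ^+ 2 + x * W + (1 + r + s - x) == 0) 1) - 1)).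
  rewrite mulr_sumr; apply: eq_bigr => r _; rewrite !mulr_sumr; apply: eq_bigr => s _.
  case: (eqVneq r 0) => [->|r0]; first by rewrite /cmul (mc0 hphi) (mc0 hBb) !(mul0r, mulr0).
  case: (eqVneq s 0) => [->|s0]; first by rewrite /cmul (mc0 hphi) (mc0 hCb) !(mul0r, mulr0).
  rewrite card_quad ?mulf_neq0 // [1 + phi _]addrC addrK.
  have -> : x ^+ 2 - 4%:R * (r * s) * (1 + r + s - x) =
     -1 * (4%:R * (r * (s * (1 - x + r + s - x ^+ 2 / 4%:R / (r * s))))).
    by field; rewrite four0 r0 s0.
  rewrite !(mcM _ _ hphi) phi4 mul1r /cmul.
  set e := phi (1 - x + _ + _ - _).
  transitivity ((phi (-1) * phi (-1)) * (phi r * cbar B r * (phi s * cbar C s) * e)).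
    by rewrite mcN1_sqr // mul1r.
  by ring.
congr (_ * _).
transitivity (\sum_r cbar B r * \sum_s cbar C s *
   (\sum_(W | r * s * W ^+ 2 + x * W + (1 + r + s - x) == 0) 1)).
  apply: eq_bigr => r _; congr (_ * _).
  under eq_bigr do rewrite mulrBr mulr1.
  by rewrite sumrB (sum_nontriv hCb (nontriv_cbar hC nC)) subr0.
apply: eq_bigr => r _; rewrite -mulr_sumr; congr (_ * _).
transitivity (\sum_s \sum_W if r * s * W ^+ 2 + x * W + (1 + r + s - x) == 0 then cbar C s else 0).
  by apply: eq_bigr => s _; rewrite mulr_sumr big_mkcond; apply: eq_bigr => W _; rewrite mulr1.
(* With [W = 1 - V] the equation becomes [(1 + r (1 - V)^2) s = x V - 1 - r]. *)
rewrite exchange_big /= (sum_shift _ 1) sum_opp; apply: eq_bigr => V _.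
rewrite -sum_linear_fiber [RHS]big_mkcond; apply: eq_bigr => s _.
congr (if _ then _ else _); rewrite -[RHS]subr_eq0; congr (_ == 0); ring.
Qed.

(** The summand is [C] of a Moebius map of [V]. Over the projective line the sum would be 0, so it
    is minus the missing value [C (2 / x)] at infinity. At [x = -2] the map is constantly [-1], and
    the [q - 1] admissible [V] contribute [C (-1)] each. *)
Lemma mobius_sum x : x != 0 ->
  \sum_V C (1 - 2%:R * V) * cbar C (- x * V - 1) =
  - (C 2%:R * cbar C x) + (x == - 2%:R)%:R * (C (-1) * q).
Proof.
move=> x0; case: (eqVneq x (- 2%:R)) => [->|x2].
  have t0 := two_neq0 oddF.
  transitivity (\sum_V C (-1) * (@eps F) (1 - 2%:R * V)).
    apply: eq_bigr => V _; rewrite /eps; case: eqP => [->|/eqP e0].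
      by rewrite (mc0 hC) mul0r mulr0.
    have -> : - - 2%:R * V - 1 = -1 * (1 - 2%:R * V) by ring.
    by rewrite (mcM _ _ hCb) !cbarE // mcN1V // mulrCA divff ?mulr1 // mc_neq0.
  rewrite -mulr_sumr (sum_scale _ (invr_neq0 t0)) sum_opp (sum_shift _ (-1)).
  under eq_bigr => V _.
    have -> : 1 - 2%:R * (2%:R^-1 * - (V - 1)) = V by field.
    over.
  rewrite sum_triv mul1r -[- 2%:R]mulN1r (mcM _ _ hCb) !cbarE // mcN1V //.
  by rewrite mulrCA divff ?mulr1 ?mc_neq0 //; ring.
rewrite mul0r addr0.
have xi0 : - x^-1 != 0 by rewrite oppr_eq0 invr_eq0.
rewrite (sum_scale _ xi0) (sum_shift _ 1).
transitivity (\sum_V cbar C x * (cbar C V * C (x + 2%:R + 2%:R * V))).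
  apply: eq_bigr => V _.
  have -> : - x * (- x^-1 * (V + 1)) - 1 = V by field.
  have -> : 1 - 2%:R * (- x^-1 * (V + 1)) = (x + 2%:R + 2%:R * V) / x by field.
  by rewrite mcD // !cbarE //; ring.
rewrite -mulr_sumr mulrC -mulNr; congr (_ * _); rewrite sum_inv.
transitivity (\sum_V eps V * C ((x + 2%:R) * V + 2%:R)).
  apply: eq_bigr => V _; rewrite /eps; case: eqP => [->|/eqP V0].
    by rewrite invr0 (mc0 hCb) !mul0r.
  by rewrite cbarE // mcV // invrK -mcM // mul1r; congr C; field.
have x20 : x + 2%:R != 0 by rewrite -[2%:R]opprK subr_eq0.
rewrite sum_eps mulr0 add0r.
have <- : \sum_V C V = \sum_V C ((x + 2%:R) * V + 2%:R).
  by rewrite [LHS](sum_shift _ 2%:R) [LHS](sum_scale _ x20).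
by rewrite sum_nontriv // sub0r.
Qed.

(* Substitute [V := (1 + s) V / s]; only [s = -1] escapes, and there both sums
   are elementary and differ exactly at [x = -2]. *)
Lemma Usum_Ysum x : x != 0 ->
  Usum x = Ysum x - (x == - 2%:R)%:R * (B (-1) * C (-1) * q).
Proof.
move=> x0; rewrite /Usum /Ysum.
have -> : (x == - 2%:R)%:R * (B (-1) * C (-1) * q) =
   \sum_s (s == -1)%:R * ((x == - 2%:R)%:R * (cbar B s * C (-1) * q)).
  by rewrite sum_delta cbarE // mcN1V.
rewrite -sumrB; apply: eq_bigr => s _; rewrite -!mulr_sumr.
case: (eqVneq s 0) => [->|s0]; first by rewrite (mc0 hBb) !(mul0r, mulr0) subr0.
case: (eqVneq s (-1)) => [->|s1].
  have -> : \sum_V C ((1 - V) ^+ 2 + V ^+ 2 / -1) * cbar C (x * V / -1 - 1) =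
     \sum_V C (1 - 2%:R * V) * cbar C (- x * V - 1).
    apply: eq_bigr => V _; congr (C _ * cbar C _); rewrite invrN1; ring.
  rewrite mobius_sum //.
  have -> : \sum_V C (1 + -1 * (1 - V) ^+ 2) * cbar C (x * V - 1 - -1) = - (C 2%:R * cbar C x).
    transitivity (\sum_V eps V * (C (2%:R - V) * cbar C x)).
      apply: eq_bigr => V _; rewrite /eps.
      have -> : 1 + -1 * (1 - V) ^+ 2 = V * (2%:R - V) by ring.
      have -> : x * V - 1 - -1 = x * V by ring.
      case: eqP => [->|/eqP V0]; first by rewrite mul0r (mc0 hC) !mul0r.
      rewrite (mcM _ _ hC) (mcM _ _ hCb) !cbarE // mul1r.
      by field; rewrite !mc_neq0.
    rewrite sum_eps subr0 -mulr_suml sum_opp (sum_shift _ (- 2%:R)).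
    under eq_bigr => V _.
      have -> : 2%:R - - (V - 2%:R) = V by ring.
      over.
    by rewrite sum_nontriv // mul0r sub0r.
  by rewrite mul1r; move: ((x == _)%:R) => d; ring.
rewrite mul0r subr0; congr (_ * _).
have s10 : 1 + s != 0 by rewrite addrC -[1]opprK subr_eq0.
have c0 : (1 + s) / s != 0 by rewrite mulf_neq0 ?invr_eq0.
(* The scale gives both arguments a factor [1 + s], on which [C] and [cbar C] cancel. *)
rewrite (sum_scale _ c0); apply: eq_bigr => V _.
have -> : 1 + s * (1 - (1 + s) / s * V) ^+ 2 = (1 + s) * ((1 - V) ^+ 2 + V ^+ 2 / s).
  by field.
have -> : x * ((1 + s) / s * V) - 1 - s = (1 + s) * (x * V / s - 1) by field.
rewrite (mcM _ _ hC) (mcM _ _ hCb) (cbarE (1 + s) hC).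
by field; rewrite mc_neq0.
Qed.

(** What is left of the Mellin transform of [Ysum] after the sum over [x] has split off; [r] stands
    for [V^2 / s]. *)
Definition Wsum N : algC :=
  \sum_V \sum_r cmul B N r * cbar (cmul (cexp B 2) N) V * C ((1 - V) ^+ 2 + r).

(** Scaling [x] by [s / V] yields the Jacobi sum. The fibre [V = 0], where this is impossible,
    contributes a multiple of the sum of [cbar B], hence 0. *)
Lemma mellin_Ysum N : mulchar N ->
  \sum_x cbar N x * Ysum x = C (-1) * jacobi (cbar N) (cbar C) * Wsum N.
Proof.
move=> hN; have hNb : mulchar (cbar N) by mcs.
have hK : mulchar (cbar (cmul (cexp B 2) N)) by mcs.
have hBN : mulchar (cmul B N) by mcs.
transitivity (\sum_V \sum_s \sum_x cbar N x * (cbar B s *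
    (C ((1 - V) ^+ 2 + V ^+ 2 / s) * cbar C (x * V / s - 1)))).
  rewrite /Ysum; under eq_bigr do rewrite mulr_sumr.
  rewrite exchange_big /= [RHS]exchange_big /=; apply: eq_bigr => s _.
  by under eq_bigr do rewrite mulr_sumr; rewrite exchange_big.
rewrite mulr_sumr; apply: eq_bigr => V _.
case: (eqVneq V 0) => [->|V0].
  transitivity (\sum_s cbar B s * (cbar C (-1) * \sum_x cbar N x)).
    apply: eq_bigr => s _; rewrite !mulr_sumr; apply: eq_bigr => x _.
    have -> : (1 - 0) ^+ 2 + 0 ^+ 2 / s = 1 by rewrite subr0 expr1n expr0n mul0r addr0.
    by rewrite mulr0 mul0r sub0r mc1 //; ring.
  rewrite -mulr_suml (sum_nontriv hBb (nontriv_cbar hB nB)) mul0r big1 ?mulr0 //.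
  by move=> r _; rewrite (mc0 hK) mulr0 mul0r.
transitivity (\sum_s cbar B s * cbar N s * N V * C ((1 - V) ^+ 2 + V ^+ 2 / s) *
   (C (-1) * jacobi (cbar N) (cbar C))).
  apply: eq_bigr => s _.
  case: (eqVneq s 0) => [->|s0].
    rewrite (mc0 hBb) !mul0r big1 // => x _; by rewrite !(mul0r, mulr0).
  have sV0 : s / V != 0 by rewrite mulf_neq0 ?invr_eq0.
  rewrite (sum_scale _ sV0) /jacobi !mulr_sumr; apply: eq_bigr => x _.
  have -> : s / V * x * V / s - 1 = -1 * (1 - x) by field; rewrite s0 V0.
  rewrite !(mcM _ _ hNb) (mcV _ hNb) (mcM _ _ hCb) (cbarE V hN) invrK (cbarE (-1) hC).
  by rewrite mcN1V //; ring.
rewrite -mulr_suml mulrC; congr (_ * _).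
have V20 : V ^+ 2 != 0 by rewrite expf_neq0.
rewrite sum_inv (sum_scale _ (invr_neq0 V20)); apply: eq_bigr => r _.
have -> : V ^+ 2 / ((V ^+ 2)^-1 * r)^-1 = r by rewrite invrK mulVKf.
rewrite (mcV _ hBb) (mcV _ hNb) (cbarE _ hB) (cbarE _ hN) !invrK.
rewrite (cbarE V (mc_cmul (mc_cexp 1 hB) hN)).
rewrite !(mcM _ _ hB) !(mcM _ _ hN) !mcV // !(mcX _ 2) // /cmul /cexp.
have := mc_neq0 hB V0; have := mc_neq0 hN V0.
by move: (N V) (B V) => n b n0 b0; field; rewrite n0 b0.
Qed.

Hypothesis nCB : nontriv (cmul phi (cmul C (cbar B))).

Lemma Wsum_eval N : mulchar N -> let D := cmul (cmul B C) N in
  q * gauss phi * Wsum N = B (-1) * D 4%:R * gauss (cmul B N) * gauss C *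
    gauss (cbar (cmul (cexp B 2) N)) * gauss (cbar (cmul (cexp C 2) N)) *
    gauss (cmul phi D).
Proof.
move=> hN D; set K := cbar (cmul (cexp B 2) N); set K' := cbar (cmul (cexp C 2) N).
have hD : mulchar D by rewrite /D; mcs.
have hBN : mulchar (cmul B N) by mcs.
have hK : mulchar K by rewrite /K; mcs.
have hK' : mulchar K' by rewrite /K'; mcs.
have hD2 : mulchar (cexp D 2) by mcs.
have q0 := card_neq0 F; have gp0 := gauss_neq0 hphi.
(* For [V <> 1], scaling [r] by [-(1 - V)^2] separates the variables. The fibre [V = 1] leaves the
   sum of [D], nonzero only for trivial [D]. *)
have WE : Wsum N = cmul B N (-1) * jacobi (cmul B N) C * jacobi K (cexp D 2) + \sum_r D r.
  rewrite /Wsum -/K [jacobi K _]/jacobi mulr_sumr.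
  rewrite -(sum_delta 1 (fun V => \sum_r D r)) -big_split; apply: eq_bigr => V _ /=.
  case: (eqVneq V 1) => [->|V1].
    rewrite subrr (mc0 hD2) !mulr0 add0r mul1r; apply: eq_bigr => r _.
    by rewrite (mc1 hK) expr0n add0r mulr1 /D /cmul; ring.
  have V10 : (1 - V) != 0 by rewrite subr_eq0 eq_sym.
  have c0 : - (1 - V) ^+ 2 != 0 by rewrite oppr_eq0 expf_neq0.
  rewrite mul0r addr0 (sum_scale _ c0) /jacobi mulr_sumr mulr_suml; apply: eq_bigr => r _.
  have -> : (1 - V) ^+ 2 + - (1 - V) ^+ 2 * r = (1 - V) ^+ 2 * (1 - r) by ring.
  rewrite -[- (1 - V) ^+ 2]mulN1r !(mcM _ _ hBN) (mcM _ _ hC) !mcX //.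
  by rewrite /cexp /D /cmul; ring.
have KN : K (-1) = N (-1).
  rewrite /K cbarE; last by mcs.
  rewrite /cmul /cexp invfM mcN1V // -exprVn mcN1V // expr2.
  by rewrite mcN1_sqr // mul1r.
have b1 := mcN1_sqr hB; have c1 := mcN1_sqr hC; have n1 := mcN1_sqr hN.
(* For trivial [D] the fibre [V = 1] supplies exactly the missing part: [Wsum N] becomes
   [q - \sum_V K V], that is 1 or [q], which equals [gauss K * gauss (cbar K)] up to sign. *)
case: (trivVnontriv hD) => [tD|nD].
  have Dz z : z != 0 -> B z * C z * N z = 1.
    by move=> z0; have := tD z; rewrite /D /cmul /eps (negbTE z0).
  have N10 : (-1 : F) != 0 by rewrite oppr_eq0 oner_eq0.
  have BNC : cmul B N = cbar C.
    apply: cfn_ext => // z z0; rewrite cbarE // /cmul.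
    by apply: (mulIf (mc_neq0 hC z0)); rewrite mulVf ?mc_neq0 // -(Dz _ z0); ring.
  have KK : K' = cbar K.
    apply: cfn_ext; [mcs|mcs|] => z z0; rewrite /K' (cbarE z hK) /K !cbarE; try by mcs.
    have e := Dz _ z0; rewrite invrK /cmul /cexp.
    have := mc_neq0 hB z0; have := mc_neq0 hC z0; have := mc_neq0 hN z0.
    move: (B z) (C z) (N z) e => b c n e n0 c0 b0.
    transitivity ((b * c * n) ^+ 2 * (c ^+ 2 * n)^-1); first by rewrite e expr1n mul1r.
    by field; rewrite n0 c0.
  have gCC := gauss_conj hC nC.
  have J1 : jacobi (cmul B N) C = - C (-1).
    apply: (mulfI q0); rewrite jacobi_gauss //; last by right.
    rewrite BNC.
    have -> : cbar (cmul (cbar C) C) = eps.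
      apply: cfn_ext; [mcs|mcs|] => z z0; rewrite cbarE; last by mcs.
      by rewrite /cmul cbarE // mulVf ?mc_neq0 // invr1 /eps (negbTE z0).
    rewrite gauss_eps cbarE // mulVf ?mc_neq0 // mul1r [gauss _ * gauss _]mulrC gCC; ring.
  have J2 : jacobi K (cexp D 2) = \sum_V K V - 1.
    rewrite -(mc1 hK) -(sum_delta 1 K) -sumrB; apply: eq_bigr => V _.
    rewrite /cexp tD /eps subr_eq0 eq_sym; case: eqP => _.
      by rewrite expr0n mulr0 mul1r subrr.
    by rewrite expr1n mulr1 mul0r subr0.
  have -> : cmul phi D = phi.
    apply: cfn_ext; [mcs|mcs|] => z z0.
    by rewrite /cmul -/(D z) tD /eps (negbTE z0) mulr1.
  have four0 := four_neq0 oddF.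
  rewrite WE (is_trivE tD) sum_triv J1 -(is_trivE tD) J2 tD /eps (negbTE four0).
  have BN1 : cmul B N (-1) = C (-1) by rewrite BNC cbarE // mcN1V.
  rewrite BN1 BNC KK mulr1.
  have bcn := Dz _ N10.
  have -> : B (-1) * gauss (cbar C) * gauss C * gauss K * gauss (cbar K) * gauss phi
     = B (-1) * (gauss C * gauss (cbar C)) * (gauss K * gauss (cbar K)) * gauss phi by ring.
  rewrite gCC.
  have -> : C (-1) * - C (-1) * (\sum_V K V - 1) + (q - 1) = q - \sum_V K V.
    by rewrite mulrN c1; ring.
  case: (trivVnontriv hK) => [tK|nK].
    have K1 : N (-1) = 1 by rewrite -KN tK /eps (negbTE N10).
    have -> : cbar K = K.
      by apply: functional_extensionality => z; rewrite cbarE // tK /eps; case: eqP; rewrite ?invr0 ?invr1.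
    rewrite (is_trivE tK) sum_triv gauss_eps.
    rewrite K1 mulr1 in bcn.
    have -> : q - (q - 1) = 1 by ring.
    by rewrite !mulrA bcn; ring.
  rewrite (sum_nontriv hK nK) subr0 (gauss_conj hK nK) KN.
  transitivity ((B (-1) * C (-1) * N (-1)) * (q * gauss phi * q)); first by rewrite bcn mul1r.
  by ring.
rewrite WE (sum_nontriv hD nD) addr0.
have j1 := jacobi_gauss hBN hC (or_intror nC).
have D_eq : cmul (cmul B N) C = D.
  by apply: functional_extensionality => z; rewrite /D /cmul; ring.
rewrite D_eq in j1.
(* If both were trivial, [D] would be [phi] and [B^2 N] trivial, so [phi C Bbar] would be trivial,
   against [nCB]. *)
have nKD : nontriv K \/ nontriv (cexp D 2).
  case: (trivVnontriv hK) => [tK|]; last by left.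
  case: (trivVnontriv hD2) => [tD2|]; last by right.
  have Dphi := order2_qphi oddF hD tD2 nD.
  case: nCB => t t0 /eqP []; rewrite -Dphi /cmul cbarE //.
  have := tK t; rewrite /K cbarE; last by mcs.
  rewrite /cmul /cexp /eps (negbTE t0) => e.
  have d2 := qphi_sqr oddF t0; rewrite -Dphi in d2.
  have := mc_neq0 hB t0; have := mc_neq0 hC t0; have := mc_neq0 hN t0.
  move: d2 e; rewrite /D /cmul; move: (B t) (C t) (N t) => b c n d2 e n0 c0 b0.
  transitivity ((b * c * n) * (b * c * n) * (b ^+ 2 * n)^-1).
    by field; rewrite n0 b0.
  by rewrite d2 e mulr1.
have j2 := jacobi_gauss hK hD2 nKD.
have KD : cbar (cmul K (cexp D 2)) = K'.
  apply: cfn_ext; [mcs|mcs|] => z z0; rewrite /K' !cbarE; try by mcs.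
  rewrite /cmul /K cbarE; last by mcs.
  rewrite /D /cmul /cexp; congr (_^-1).
  by field; rewrite !mc_neq0.
rewrite KD in j2.
(* The order 2 relation splits [gauss (cexp D 2)]; its factor [gauss D] then cancels against the
   [gauss (cbar D)] of the first Jacobi sum. *)
have hd := hasse_davenport2 oddF hD.
have gd := gauss_conj hD nD.
have D2N : cexp D 2 (-1) = 1 by rewrite /cexp expr2 mcN1_sqr.
rewrite KN D2N mulr1 in j2.
apply: (mulfI q0).
transitivity (gauss phi * cmul B N (-1) * (q * jacobi (cmul B N) C) * (q * jacobi K (cexp D 2))).
  by ring.
rewrite j1 j2.
transitivity (cmul B N (-1) * cmul B N (-1) * C (-1) * gauss (cmul B N) * gauss C *
   gauss (cbar D) * (N (-1) * gauss K) * gauss K' * (gauss (cexp D 2) * gauss phi)).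
  by ring.
rewrite -hd mcN1_sqr // mul1r.
transitivity (C (-1) * N (-1) * (gauss D * gauss (cbar D)) * gauss (cmul B N) * gauss C *
   gauss K * gauss K' * (D 4%:R * gauss (cmul phi D))); first by ring.
rewrite gd {1}/D /cmul.
transitivity ((C (-1) * C (-1)) * (N (-1) * N (-1)) * (q * (B (-1) * D 4%:R * gauss (cmul B N) *
  gauss C * gauss K * gauss K' * gauss (cmul phi D)))); first by rewrite /cmul; ring.
by rewrite c1 n1 !mul1r.
Qed.

Hypothesis na : nontriv (cmul phi (cmul B C)).

(** The Mellin coefficients agree. As the lower parameters are squares, the order 2 relation
    evaluates the normalizing Gauss sums; its factors [B 4] and [C 4] cancel those of [D 4] in
    [Wsum_eval], and the remaining [N 4] is the 4 in the argument. *)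
Lemma F32_Ysum x : x != 0 ->
  F32 (cmul phi (cmul B C)) B C (cexp B 2) (cexp C 2) (4%:R * x) =
  gauss phi * phi (-1) / (gauss (cmul phi (cmul B C)) * gauss (cmul phi (cbar B)) *
     gauss (cmul phi (cbar C))) * Ysum x.
Proof.
move=> x0; set a := cmul phi (cmul B C).
have four0 := four_neq0 oddF.
have ha : mulchar a by rewrite /a; mcs.
have hB2 : mulchar (cexp B 2) by mcs.
have hC2 : mulchar (cexp C 2) by mcs.
have sqE (X : cfn F) : mulchar X -> cmul (cbar X) (cexp X 2) = X.
  move=> hX; apply: cfn_ext; [mcs|mcs|] => z z0.
  by rewrite /cmul /cexp cbarE //; field; apply: mc_neq0.
have bsqE (X : cfn F) : cexp (cbar X) 2 = cbar (cexp X 2).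
  by apply: functional_extensionality => z; rewrite /cexp /cbar rmorphXn.
apply: (mulfI (cardB1_neq0 F)).
rewrite F32_expand ?sqE ?mulf_neq0 // [RHS]mulrCA mellin_inv // [RHS]mulr_sumr.
apply: eq_bigr => i _; have hN := mc_ch i; move: (ch i) hN => N hN.
rewrite mellin_Ysum // -!mulrA.
have hBp : mulchar (cmul phi (cbar B)) by mcs.
have hCp : mulchar (cmul phi (cbar C)) by mcs.
have q0 := card_neq0 F; have gp0 := gauss_neq0 hphi.
have ga0 := gauss_neq0 ha; have gB0 := gauss_neq0 hB; have gC0 := gauss_neq0 hC.
have gBp0 := gauss_neq0 hBp; have gCp0 := gauss_neq0 hCp.
have N10 : (-1 : F) != 0 by rewrite oppr_eq0 oner_eq0.
have b0 := mc_neq0 hB N10; have c0 := mc_neq0 hC N10.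
have B40 := mc_neq0 hB four0; have C40 := mc_neq0 hC four0.
have gbar (X : cfn F) : mulchar X -> nontriv X -> gauss (cbar X) = q / (X (-1) * gauss X).
  move=> hX nX; have X10 := mc_neq0 hX N10; have gX0 := gauss_neq0 hX.
  have -> : q = X (-1) * X (-1) * q by rewrite mcN1_sqr // mul1r.
  by rewrite -[X (-1) * X (-1) * q]mulrA -(gauss_conj hX nX); field; rewrite gX0 X10.
have gsq (X : cfn F) : mulchar X -> nontriv X -> gauss (cbar (cexp X 2)) =
    q / (X (-1) * gauss X) * gauss (cmul phi (cbar X)) / (X 4%:R * gauss phi).
  move=> hX nX; have hd := hasse_davenport2 oddF (mc_cbar hX).
  rewrite bsqE cbarE // in hd.
  apply: (mulIf gp0); rewrite -hd gbar //.
  by field; rewrite gp0 mc_neq0 ?mc_neq0 ?gauss_neq0.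
have JE : jacobi (cbar N) (cbar C) = N (-1) * C (-1) * gauss (cbar N) *
    (q / (C (-1) * gauss C)) * gauss (cmul C N) / q.
  apply: (mulfI q0); rewrite jacobi_gauss; [|mcs|mcs|by right; apply: nontriv_cbar].
  have -> : cbar (cmul (cbar N) (cbar C)) = cmul C N.
    by apply: functional_extensionality => z; rewrite /cmul /cbar rmorphM /= !conjCK mulrC.
  rewrite !cbarE // !mcN1V // (gbar _ hC nC).
  by field; rewrite q0 gC0 c0.
have WE : Wsum N = B (-1) * (B 4%:R * C 4%:R * N 4%:R) * gauss (cmul B N) * gauss C *
    gauss (cbar (cmul (cexp B 2) N)) * gauss (cbar (cmul (cexp C 2) N)) *
    gauss (cmul a N) / (q * gauss phi).
  apply: (mulfI (mulf_neq0 q0 gp0)); rewrite Wsum_eval //.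
  have -> : cmul phi (cmul (cmul B C) N) = cmul a N.
    by apply: functional_extensionality => z; rewrite /a /cmul; ring.
  by rewrite {1}/cmul {1}/cmul; field; rewrite q0 gp0.
have pE : phi (-1) = gauss phi * gauss phi / q by rewrite gauss_qphi_sqr // mulfK.
have NE : N (- (4%:R * x)) = N (-1) * N 4%:R * N x.
  by rewrite -!(mcM _ _ hN) -mulrA mulN1r.
rewrite JE WE !gsq // pE NE.
by field; rewrite gp0 q0 ga0 gB0 gC0 gBp0 gCp0 b0 c0 B40 C40.
Qed.

(* The exponents add up so that the sum over [u] is homogeneous and collapses
   to a single quadratic Gauss sum. *)
Lemma character_sum_Usum x : x != 0 ->
  \sum_(i : mchar F) ch i (- (x ^+ 2 / 4%:R)) *
    (gauss (cbar (ch i)) * gauss (cmul (cmul phi (cbar B)) (cbar (ch i))) *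
       gauss (cmul (cmul phi (cbar C)) (cbar (ch i)))) *
    (\sum_u cmul (cmul phi (cmul B C)) (cexp (ch i) 3) u * psi ((1 - x) * u)) =
  (#|F|%:R - 1) * (gauss phi * phi (-1) * Usum x).
Proof.
move=> x0; set a := cmul phi (cmul B C).
set X := cmul phi (cbar B); set Y := cmul phi (cbar C).
have four0 := four_neq0 oddF.
have ha : mulchar a by rewrite /a; mcs.
have hX : mulchar X by rewrite /X; mcs.
have hY : mulchar Y by rewrite /Y; mcs.
have xx0 : x ^+ 2 / 4%:R != 0 by rewrite mulf_neq0 ?invr_eq0 ?expf_neq0.
under eq_bigr do rewrite mulr_sumr.
rewrite exchange_big /=.
transitivity (\sum_u (q - 1) * \sum_r \sum_s X r * Y s * (phi u *
    psi ((1 - x + r + s - x ^+ 2 / 4%:R / (r * s)) * u))).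
  apply: eq_bigr => u _; case: (eqVneq u 0) => [->|u0].
    rewrite big1 => [|i _].
      rewrite big1 ?mulr0 // => r _; rewrite big1 // => s _.
      by rewrite (mc0 hphi) mul0r mulr0.
    by rewrite (mc0 (mc_cmul ha (mc_cexp 2 (mc_ch i)))) mul0r mulr0.
  pose t := - (x ^+ 2 / 4%:R) * u ^+ 3.
  have t0 : t != 0 by rewrite mulf_neq0 ?oppr_eq0 ?expf_neq0.
  transitivity (a u * psi ((1 - x) * u) * \sum_(i : mchar F) ch i t *
     (gauss (cbar (ch i)) * gauss (cmul X (cbar (ch i))) * gauss (cmul Y (cbar (ch i))))).
    rewrite mulr_sumr; apply: eq_bigr => i _.
    rewrite /t (mcM _ _ (mc_ch i)) (mcX _ _ (mc_ch i)).
    have -> : cmul a (cexp (ch i) 3) u = a u * ch i u ^+ 3 by [].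
    by ring.
  rewrite gauss_triple_sum // mulrCA; congr (_ * _).
  rewrite (sum_scale _ u0) mulr_sumr; apply: eq_bigr => r _.
  rewrite (sum_scale _ u0) mulr_sumr; apply: eq_bigr => s _.
  case: (eqVneq r 0) => [->|r0]; first by rewrite mulr0 (mc0 hX) !(mul0r, mulr0).
  case: (eqVneq s 0) => [->|s0]; first by rewrite mulr0 (mc0 hY) !(mul0r, mulr0).
  rewrite (mcM _ _ hX) (mcM _ _ hY).
  have aXY : a u * X u * Y u = phi u.
    rewrite /a /X /Y /cmul !cbarE //.
    have := qphi_sqr oddF u0; have := mc_neq0 hB u0; have := mc_neq0 hC u0.
    move: (phi u) (B u) (C u) => p b c c0 b0 p2.
    by transitivity (p * p * p); [field; rewrite c0 b0 | rewrite p2 mul1r].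
  have -> : psi ((1 - x + r + s - x ^+ 2 / 4%:R / (r * s)) * u) =
     psi ((1 - x) * u) * psi (u * r + u * s + t / (u * r * (u * s))).
    by rewrite -psiD; congr psi; rewrite /t; field; rewrite four0 r0 s0 u0.
  by rewrite -aXY; ring.
rewrite -mulr_sumr; congr (_ * _); rewrite -mulrA -quadratic_sum_Usum //.
rewrite exchange_big mulr_sumr /=; apply: eq_bigr => r _.
rewrite exchange_big mulr_sumr /=; apply: eq_bigr => s _.
rewrite -mulr_sumr gauss_scale_nontriv ?qphiV //; last exact: qphi_nontriv.
by rewrite -/X -/Y; ring.
Qed.

End CubicTransformation.

(** * The transformation formula: nontriviality conditions, then the cases of [x] *)

Theorem mainTheorem10 (F : finFieldType) (eta A B : mchar F)
  (hq : (#|F| %% 6 = 1)%N)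
  (heta3 : is_triv (cexp (ch eta) 3)) (heta1 : ~ is_triv (ch eta))
  (h1 : ~ is_triv (cexp (ch A) 3))
  (h2 : ~ is_triv (ch B))
  (h3 : ~ is_triv (cmul (cexp (ch A) 3) (cexp (cbar (ch B)) 2)))
  (h4 : ~ is_triv (cmul (cexp (ch A) 6) (cexp (cbar (ch B)) 3)))
  (h5 : ~ is_triv (cmul qphi (cmul (cexp (ch A) 3) (cbar (ch B)))))
  (h6 : ~ is_triv (cmul qphi (cmul (cexp (ch A) 3) (cexp (cbar (ch B)) 3))))
  (x : F) :
  (if x == 1 then 0 else
     cexp (cbar (ch A)) 3 (1 - x) *
     F32 (ch A) (cmul (ch A) (ch eta)) (cmul (ch A) (cbar (ch eta)))
         (cmul qphi (ch B)) (cmul (cexp (ch A) 3) (cbar (ch B)))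
         (27%:R * x ^+ 2 / (4%:R * (1 - x) ^+ 3)))
  = F32 (cexp (ch A) 3) (ch B) (cmul qphi (cmul (cexp (ch A) 3) (cbar (ch B))))
        (cexp (ch B) 2) (cmul (cexp (ch A) 6) (cexp (cbar (ch B)) 2)) (4%:R * x)
    - delta (x + 2%:R) *
        (gauss (@qphi F) * gauss (cexp (cbar (ch A)) 3) /
         (gauss (cmul qphi (cbar (ch B))) * gauss (cmul (cexp (cbar (ch A)) 3) (ch B))))
    - delta (1 - x) *
        \sum_(c : mchar F | [forall y : F, cexp (ch c) 3 y == cexp (cbar (ch A)) 3 y])
          (gauss (cbar (ch c)) * gauss (cmul qphi (cbar (cmul (ch B) (ch c))))
           * gauss (cmul (ch B) (cbar (cmul (cexp (ch A) 3) (ch c))))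
           / (gauss (cmul qphi (cbar (ch B))) * gauss (cmul (cexp (cbar (ch A)) 3) (ch B))
              * gauss (cexp (ch A) 3))
           * cbar (ch c) (- 4%:R)).
Proof.
have oddF : odd #|F|.
  have : (#|F| %% 6 %% 2 = #|F| %% 2)%N by apply: modn_dvdm.
  by rewrite hq !modn2; case: (odd #|F|).
have F3 : (#|F| %% 3 = 1)%N.
  have : (#|F| %% 6 %% 3 = #|F| %% 3)%N by apply: modn_dvdm.
  by rewrite hq => <-.
have hA := mc_ch A; have hb := mc_ch B; have he := mc_ch eta; have hp := mc_qphi oddF.
move: (ch A) (ch B) (ch eta) hA hb he heta3 heta1 h1 h2 h3 h4 h5 h6 => {eta A B}.
move=> A B eta hA hB he eta3 eta1 h1 h2 h3 h4 h5 h6.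
pose a := cexp A 3; pose C := cmul qphi (cmul a (cbar B)).
have ha : mulchar a by rewrite /a; mcs.
have hC : mulchar C by rewrite /C; mcs.
have phi2 (z : F) : z != 0 -> qphi z * qphi z = 1 by apply: qphi_sqr.
have ea : cmul qphi (cmul B C) = a.
  apply: cfn_ext; [mcs|mcs|] => z z0; rewrite /C /cmul cbarE // -[RHS]mul1r -(phi2 z z0).
  by field; apply: mc_neq0.
have eabar : cexp (cbar A) 3 = cbar a.
  by apply: functional_extensionality => z; rewrite /cexp /a /cbar rmorphXn.
have ephiC : cmul (cexp (cbar A) 3) B = cmul qphi (cbar C).
  rewrite eabar; apply: cfn_ext; [mcs|mcs|] => z z0.
  rewrite /cmul (cbarE _ ha) (cbarE _ hC) /C /cmul cbarE // !invfM invrK qphiV.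
  by rewrite [RHS]mulrA phi2 // mul1r.
have eC2 : cmul (cexp A 6) (cexp (cbar B) 2) = cexp C 2.
  apply: cfn_ext; [mcs|mcs|] => z z0; rewrite /C /a /cmul /cexp cbarE //.
  rewrite [in RHS]exprMn [qphi z ^+ 2]expr2 phi2 // mul1r.
  by field; apply: mc_neq0.
have na : nontriv a by apply: nontrivP.
have nB : nontriv B by apply: nontrivP.
have nC : nontriv C by apply: nontrivP.
have nCB : nontriv (cmul qphi (cmul C (cbar B))).
  apply: nontrivP; first by mcs.
  suff -> : cmul qphi (cmul C (cbar B)) = cmul (cexp A 3) (cexp (cbar B) 2) by [].
  apply: cfn_ext; [mcs|mcs|] => z z0; rewrite /C /a /cmul /cexp cbarE //.
  by rewrite -[RHS]mul1r -(phi2 z z0); field; apply: mc_neq0.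
have neta : nontriv eta by apply: nontrivP.
have nA : nontriv A.
  case: (trivVnontriv hA) => // tA; case: h1 => z; rewrite /cexp tA /eps.
  by case: eqP; rewrite ?expr0n ?expr1n.
have eta3z (z : F) : z != 0 -> eta z ^+ 3 = 1.
  by move=> z0; have := eta3 z; rewrite /cexp /eps (negbTE z0).
(* Cubing removes [eta]: the cube of this character is the conjugate of the one in [h6]. *)
have n2 : nontriv (cmul (cbar (cmul A eta)) (cmul qphi B)).
  apply: nontrivP; first by mcs.
  move=> t; apply: h6 => z; case: (eqVneq z 0) => [->|z0].
    by rewrite (mc0 (mc_eps F)) mc0 //; mcs.
  have := t z; rewrite /eps (negbTE z0) /cmul /cexp !cbarE //; last by mcs.
  rewrite /cmul => e.
  have e3 := eta3z z z0; have p2 := phi2 z z0.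
  have := mc_neq0 hA z0; have := mc_neq0 hB z0; have := mc_neq0 he z0; have := mc_neq0 hp z0.
  move: e e3 p2; move: (A z) (B z) (eta z) (qphi z) => u v w p e e3 p2 p0 w0 v0 u0.
  transitivity (p * p * (p * p) * (w ^+ 3)^-1 * (((u * w)^-1 * (p * v)) ^+ 3)^-1).
    by field; rewrite p0 w0 v0 u0.
  by rewrite e p2 e3 expr1n !(mulr1, invr1).
(* Likewise, the cube of this character is the one in [h4]. *)
have n3 : nontriv (cmul (cbar (cmul A (cbar eta))) (cmul (cexp A 3) (cbar B))).
  apply: nontrivP; first by mcs.
  move=> t; apply: h4 => z; case: (eqVneq z 0) => [->|z0].
    by rewrite (mc0 (mc_eps F)) mc0 //; mcs.
  have := t z; rewrite /eps (negbTE z0) /cmul /cexp !cbarE //; last by mcs.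
  move=> e.
  have e3 := eta3z z z0.
  have := mc_neq0 hA z0; have := mc_neq0 hB z0; have := mc_neq0 he z0.
  move: e e3; move: (A z) (B z) (eta z) => u v w e e3 w0 v0 u0.
  transitivity ((w ^+ 3)^-1 * ((u * w^-1)^-1 * (u ^+ 3 * v^-1)) ^+ 3).
    by field; rewrite w0 v0 u0.
  by rewrite e e3 expr1n !(mulr1, invr1).
have two0 := two_neq0 oddF; have four0 := four_neq0 oddF; have three0 := three_neq0 F3.
have n27 : (27%:R : F) != 0 by rewrite (natrX _ 3 3) expf_neq0.
have nBB : nontriv (cmul (cbar B) (cexp B 2)).
  suff -> : cmul (cbar B) (cexp B 2) = B by [].
  apply: cfn_ext; [mcs|mcs|] => z z0.
  by rewrite /cmul /cexp cbarE //; field; apply: mc_neq0.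
have nCC : nontriv (cmul (cbar C) (cexp C 2)).
  suff -> : cmul (cbar C) (cexp C 2) = C by [].
  apply: cfn_ext; [mcs|mcs|] => z z0.
  by rewrite /cmul /cexp cbarE //; field; apply: mc_neq0.
rewrite ephiC eC2 eabar -/a -/C.
have hphiB : mulchar (cmul qphi B) by mcs.
have haB : mulchar (cmul a (cbar B)) by mcs.
have hAe : mulchar (cmul A eta) by mcs.
have hAe' : mulchar (cmul A (cbar eta)) by mcs.
have hB2 : mulchar (cexp B 2) by mcs.
have hC2 : mulchar (cexp C 2) by mcs.
have hab := mc_cbar ha.
case: (eqVneq x 0) => [->|x0].
  rewrite eq_sym oner_eq0 subr0 (mc1 hab) expr0n !mulr0 mul0r !F32_0 //.
  by rewrite /delta add0r (negbTE two0) oner_eq0 !mul0r !subr0 mulr1.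
have hBp : mulchar (cmul qphi (cbar B)) by mcs.
have hCp : mulchar (cmul qphi (cbar C)) by mcs.
have ga0 := gauss_neq0 ha.
have gBp0 := gauss_neq0 hBp; have gCp0 := gauss_neq0 hCp.
have q0 := card_neq0 F; have q10 := cardB1_neq0 F.
have RE : F32 a B C (cexp B 2) (cexp C 2) (4%:R * x) =
    gauss (@qphi F) * qphi (-1 : F) / (gauss a * gauss (cmul qphi (cbar B)) *
     gauss (cmul qphi (cbar C))) * Ysum B C x.
  by rewrite -{1}ea F32_Ysum // ea.
have := character_sum_Usum oddF hB hC nC x0; rewrite ea => CS.
have UY := Usum_Ysum oddF hB hC nC x0.
(* At [x = 1], which differs from [-2] as [3 <> 0], the inner sum over [u] has no additive factor:
   it is [q - 1] when [a N^3] is trivial and 0 otherwise, which selects the [chi] of the last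
   term. *)
rewrite RE; case: (eqVneq x 1) => [x1|x1].
  rewrite x1 in CS UY *.
  have x12 : (1 == - 2%:R :> F) = false.
    by rewrite -subr_eq0 opprK -(natrD _ 1 2) (negbTE three0).
  have d3 : delta (1 + 2%:R : F) = 0 by rewrite /delta -(natrD _ 1 2) (negbTE three0).
  rewrite d3 subrr /delta eqxx mul0r subr0 mul1r.
  rewrite x12 mul0r subr0 in UY; rewrite -UY.
  apply/esym/eqP; rewrite subr_eq0; apply/eqP.
  apply: (mulfI q10).
  transitivity ((#|F|%:R - 1) * (gauss (@qphi F) * qphi (-1 : F) * Usum B C 1) /
     (gauss a * gauss (cmul qphi (cbar B)) * gauss (cmul qphi (cbar C)))).
    by field; rewrite ga0 gBp0 gCp0.
  rewrite -CS [LHS]mulr_suml [RHS]mulr_sumr [RHS]big_mkcond; apply: eq_bigr => i _.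
  have hN := mc_ch i; move: (ch i) hN => N hN.
  have hN3 : mulchar (cmul a (cexp N 3)) by mcs.
  under eq_bigr do rewrite subrr mul0r psi0 mulr1.
  case: ifP => [/forallP tN|ntN].
    have -> : cmul a (cexp N 3) = eps.
      apply: cfn_ext; [mcs|mcs|] => z z0.
      by rewrite /cmul (eqP (tN z)) cbarE // divff ?mc_neq0 // /eps (negbTE z0).
    rewrite sum_triv.
    have -> : cmul qphi (cbar (cmul B N)) = cmul (cmul qphi (cbar B)) (cbar N).
      by apply: functional_extensionality => z; rewrite /cmul /cbar rmorphM /=; ring.
    have -> : cmul B (cbar (cmul a N)) = cmul (cmul qphi (cbar C)) (cbar N).
      rewrite -ephiC eabar; apply: functional_extensionality => z.
      by rewrite /cmul /cbar rmorphM /=; ring.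
    have -> : cbar N (- 4%:R) = N (- (1 ^+ 2 / 4%:R)).
      by rewrite cbarE // -mcV //; congr N; rewrite expr1n invrN div1r.
    by field; rewrite ga0 gBp0 gCp0.
  rewrite sum_nontriv ?mulr0 ?mul0r //; apply: nontrivP => // t.
  case/negP: (negbT ntN); apply/forallP => z; apply/eqP.
  case: (eqVneq z 0) => [->|z0]; first by rewrite (mc0 hab) /cexp (mc0 hN) expr0n.
  apply: (mulfI (mc_neq0 ha z0)); have := t z; rewrite /eps (negbTE z0) {1}/cmul => ->.
  by rewrite cbarE // divff // mc_neq0.
have y0 : 1 - x != 0 by rewrite subr_eq0 eq_sym.
have dy : delta (1 - x) = 0 by rewrite /delta (negbTE y0).
(* For [x <> 1] the inner sum is the Gauss sum of [a N^3] divided by its value at [1 - x]; this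
   value accounts for the prefactor and for [(1 - x)^3] in the argument. *)
have LE : cbar a (1 - x) *
   F32 A (cmul A eta) (cmul A (cbar eta)) (cmul qphi B) (cmul a (cbar B))
    (27%:R * x ^+ 2 / (4%:R * (1 - x) ^+ 3)) =
   gauss (@qphi F) * qphi (-1 : F) / (gauss a * gauss (cmul qphi (cbar B)) *
     gauss (cmul qphi (cbar C))) * Usum B C x.
  apply: (mulfI q10); rewrite mulrCA F32_expand //; last first.
    by rewrite !mulf_neq0 ?invr_eq0 ?mulf_neq0 ?expf_neq0.
  transitivity ((#|F|%:R - 1) * (gauss (@qphi F) * qphi (-1 : F) * Usum B C x) /
     (gauss a * gauss (cmul qphi (cbar B)) * gauss (cmul qphi (cbar C)))); last first.
    by field; rewrite ga0 gBp0 gCp0.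
  rewrite -CS [RHS]mulr_suml [LHS]mulr_sumr; apply: eq_bigr => i _.
  have hN := mc_ch i; move: (ch i) hN => N hN.
  have hN3 : mulchar (cmul a (cexp N 3)) by mcs.
  rewrite gauss_scale //.
  have hAN : mulchar (cmul A N) by mcs.
  have hd1 := hasse_davenport3 oddF F3 he eta3 neta hAN.
  have hd0 := hasse_davenport3 oddF F3 he eta3 neta hA; rewrite -/a in hd0.
  have e1 : cmul (cmul A N) eta = cmul (cmul A eta) N.
    by apply: functional_extensionality => z; rewrite /cmul mulrAC.
  have e2 : cmul (cmul A N) (cbar eta) = cmul (cmul A (cbar eta)) N.
    by apply: functional_extensionality => z; rewrite /cmul mulrAC.
  have e3 : cexp (cmul A N) 3 = cmul a (cexp N 3).
    by apply: functional_extensionality => z; rewrite /a /cmul /cexp exprMn.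
  rewrite e1 e2 e3 in hd1.
  have A27 := mc_neq0 hA n27; have N27 := mc_neq0 hN n27.
  have P1 : gauss (cmul A N) * gauss (cmul (cmul A eta) N) * gauss (cmul (cmul A (cbar eta)) N)
     = #|F|%:R * gauss (cmul a (cexp N 3)) / (A 27%:R * N 27%:R).
    by rewrite -hd1 (_ : cmul A N 27%:R = A 27%:R * N 27%:R) // [RHS]mulrC mulKf // mulf_neq0.
  have P0 : gauss A * gauss (cmul A eta) * gauss (cmul A (cbar eta))
     = #|F|%:R * gauss a / A 27%:R.
    by rewrite -hd0 [RHS]mulrC mulKf.
  have -> : cbar (cmul (cmul qphi B) N) = cmul (cmul qphi (cbar B)) (cbar N).
    apply: functional_extensionality => z; rewrite /cmul /cbar !rmorphM /=.
    by rewrite (mc_conj _ hp) qphiV.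
  have -> : cbar (cmul qphi B) = cmul qphi (cbar B).
    apply: functional_extensionality => z; rewrite /cmul /cbar !rmorphM /=.
    by rewrite (mc_conj _ hp) qphiV.
  have eaB : cbar (cmul a (cbar B)) = cmul qphi (cbar C).
    by rewrite -ephiC eabar; apply: functional_extensionality => z; rewrite /cmul /cbar rmorphM /= conjCK.
  have -> : cbar (cmul (cmul a (cbar B)) N) = cmul (cmul qphi (cbar C)) (cbar N).
    by rewrite -eaB; apply: functional_extensionality => z; rewrite {1}/cmul /cbar rmorphM.
  rewrite eaB P1 P0.
  have -> : N (- (27%:R * x ^+ 2 / (4%:R * (1 - x) ^+ 3))) =
     N (- (x ^+ 2 / 4%:R)) * N 27%:R / N (1 - x) ^+ 3.
    rewrite -mcX // -mcM // -mcD //; congr N.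
    by field; rewrite four0 y0.
  rewrite cbarE // [cmul a (cexp N 3) (1 - x)]/cmul [cexp N 3 (1 - x)]/cexp.
  have ay0 := mc_neq0 ha y0; have Ny0 := mc_neq0 hN y0.
  by field; rewrite ga0 gBp0 gCp0 q0 A27 N27 ay0 Ny0.
rewrite LE UY dy mul0r subr0 mulrBr; congr (_ - _).
rewrite /delta -[2%:R in LHS]opprK; have -> : (x + 2%:R == 0) = (x == - 2%:R) by rewrite addr_eq0.
rewrite opprK; case: eqP => _; last by rewrite !mul0r mulr0.
rewrite !mul1r.
(* The correction at [x = -2] takes its stated form through
   [gauss a * gauss (cbar a) = a (-1) * q]. *)
have a1 : a (-1) = qphi (-1 : F) * (B (-1) * C (-1)).
  by have := congr1 (fun f : cfn F => f (-1)) ea; rewrite /cmul => <-.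
have gg := gauss_conj ha na; rewrite a1 in gg.
have -> : gauss (cbar a) = qphi (-1 : F) * (B (-1) * C (-1)) * #|F|%:R / gauss a.
  by rewrite -gg [RHS]mulrC mulKf.
by field; rewrite ga0 gBp0 gCp0.
Qed.
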